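(* Let $G$ be a finite solvable group and let $V \neq 0$ be a finite faithful completely reducible $G$-module, possibly of mixed characteristic. Then $$|G/G^c| < |V|,$$ where $G^c = [[G,G],G]$.
   Context: For a finite group $G$, write $G' = [G,G]$ for the commutator subgroup and put $G^c = [G,G,G] = [G',G]$. Thus $G^c$ is the third term of the lower central series of $G$, i.e. the intersection of all normal subgroups $N$ of $G$ such that $G/N$ is nilpotent of class at most 2, and $G/G^c$ is the maximal class 2 quotient of $G$. A finite completely reducible $G$-module $V$, possibly of mixed characteristic, is a finite abelian group with an action of $G$ by automorphisms which is a direct sum of irreducible $G$-modules, where each irreducible summand is a vector space over a finite prime field and different summands may have different characteristics. Faithful means that only the identity of $G$ acts trivially on $V$. *)

(* Defs.v *)
From mathcomp Require Import all_boot all_fingroup all_solvable.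

Set Implicit Arguments.
Unset Strict Implicit.
Unset Printing Implicit Defensive.

Import GroupScope.

(* A finite G-module, possibly of mixed characteristic, is a finite abelian
   group V, written multiplicatively, with [to : groupAction G V].  The summands
   need no assumption that they are vector spaces over a prime field: if W is
   abelian and irreducible, its p-th powers form an invariant subgroup for every
   prime p, so W is elementary abelian. *)
Definition completely_reducible (gT vT : finGroupType) (G : {group gT})
    (V : {group vT}) (to : groupAction G V) : Prop :=
  exists (n : nat) (W : 'I_n -> {group vT}),
    \big[dprod/1]_(i < n) (W i : {set vT}) = V
    /\ forall i : 'I_n, acts_irreducibly G (W i) to.

(* Main.v *)
(* Write L(X) for the third term of the lower central series of X.  Inside the
   semidirect product of V by G, filter G by the centralizers of the irreducible
   summands W of V.  The index of L(G) in G is at most the product over W of the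
   indices of L(Y) C_Y(W) in Y, for suitable normal subgroups Y of G.  Hence it
   suffices to bound each factor by |W| - 1.  In Y / C_Y(W) we are in the case of
   a solvable group G with O_p(G) = 1 acting faithfully on an abelian p-group V.

   In that case let H be a nilpotent supplement of L(G), and among the
   H-invariant subgroups of the Fitting subgroup on which O_p(H) acts faithfully
   choose a minimal one, C.  Minimality forces C to have class at most 2, each
   O_r(H) to centralize O_r(C), and O_p(H) to fix only elements of Phi(C).  With
   Q = C_H(C), the coprime nilpotent case applied to H on the Frattini quotients
   of the O_r(C) gives [H : L(H)] <= [C : Phi(C)] [Q : L(Q)], which is at most
   [CQ : L(CQ)].  As CQ is a nilpotent p'-group, the coprime nilpotent case bounds
   the latter by |V|.

   The coprime nilpotent case is an induction on |V| that reduces to a faithful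
   irreducible action.  If every normal abelian subgroup of every Sylow subgroup
   is cyclic, then the Sylow subgroups are cyclic or 2-groups of maximal class,
   and either G acts semiregularly or a noncentral involution splits V into two
   large parts.  Otherwise a normal elementary abelian subgroup of order q^2
   yields a normal subgroup K of index q and a K-invariant V0 whose q conjugates
   decompose V.  Induction on these blocks gives the bound unless G is a q-group
   and all estimates are essentially equalities.  For odd q this contradicts the
   bound q |G| <= |V|^2 for odd q-groups.  For q = 2 the structure of the
   centralizer in K of the other block forces |V0| to be a prime or 9, and both
   are impossible. *)
Require Import Defs.
From mathcomp Require Import all_boot ssralg all_fingroup all_solvable.
From mathcomp Require Import zify.

Set Implicit Arguments.
Unset Strict Implicit.
Unset Printing Implicit Defensive.

Import GroupScope.

(** * Coprime action and layered index bounds *)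

Section Coprime.

Variable gT : finGroupType.
Implicit Types A G V : {group gT}.

(** [A] acts trivially on [G / [~: G, A]], and fixed points lift along a quotient under coprime
    action. *)
Lemma coprime_comm_cent_mul A G :
  A \subset 'N(G) -> coprime #|G| #|A| -> solvable G ->
  [~: G, A] * 'C_G(A) = G.
Proof.
move=> nGA coGA solG; have sRG: [~: G, A] \subset G by rewrite commg_subl.
have nRG: G \subset 'N([~: G, A]) by apply: commg_norml.
have nRA: A \subset 'N([~: G, A]) by apply: commg_normr.
apply/eqP; rewrite eqEsubset mul_subG ?subsetIl //=.
rewrite -quotientSK // coprime_quotient_cent // subsetI subxx /=.
by apply: quotient_cents2r.
Qed.

Lemma coprime_comm_idem A G :
  A \subset 'N(G) -> coprime #|G| #|A| -> solvable G ->
  [~: G, A, A] = [~: G, A].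
Proof.
move=> nGA coGA solG; have defG := coprime_comm_cent_mul nGA coGA solG.
have /commG1P cCA: 'C_G(A) \subset 'C(A) by apply: subsetIr.
rewrite -[in RHS]defG commMG; first by rewrite cCA mulg1.
have nA: 'C_G(A) \subset 'N(A) by rewrite cents_norm ?subsetIr.
by rewrite !normsR // (subset_trans (subsetIl _ _)) ?normG.
Qed.

Lemma coprime_stab A G :
  A \subset 'N(G) -> coprime #|G| #|A| -> solvable G ->
  [~: G, A] \subset 'C(A) -> A \subset 'C(G).
Proof.
move=> nGA coGA solG /commG1P R1; rewrite centsC; apply/commG1P.
by rewrite -coprime_comm_idem.
Qed.

Lemma coprime_abel_card A V :
  A \subset 'N(V) -> coprime #|V| #|A| -> abelian V ->
  (#|[~: V, A]| * #|'C_V(A)|)%N = #|V|.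
Proof.
move=> nVA coVA abV.
rewrite -{3}(coprime_comm_cent_mul nVA coVA (abelian_sol abV)) TI_cardMg //.
have sR: [~: V, A] \subset V by rewrite commg_subl.
apply/trivgP; rewrite -(coprime_abel_cent_TI nVA coVA abV) subsetI subsetIl.
by rewrite (subset_trans (subsetIr _ _)) // subsetIr.
Qed.

(** [A] already centralizes ['C_V(A)], the complement of [[~: V, A]] in [V]. *)
Lemma coprime_comm_faithful A V :
  A \subset 'N(V) -> coprime #|V| #|A| -> abelian V ->
  'C_A([~: V, A]) = 'C_A(V).
Proof.
move=> nVA coVA abV; have sR: [~: V, A] \subset V by rewrite commg_subl.
apply/eqP; rewrite eqEsubset (setIS _ (centS sR)) andbT subsetI subsetIl /=.
rewrite -{2}(coprime_comm_cent_mul nVA coVA (abelian_sol abV)) centM subsetI.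
by rewrite subsetIr (subset_trans (subsetIl _ _)) // centsC subsetIr.
Qed.

End Coprime.

Section Layers.

Variable gT : finGroupType.
Implicit Types D E G M U V Y : {group gT}.

(** Insert [D <*> Y1] between [D <*> M] and [Y]: it is the product of [D <*> M] and [Y1], and
    [E <*> M] lies in their intersection. This removes one layer when [Y1] is the kernel on that
    layer. *)
Lemma index_join_leq Y D Y1 E M :
    D <| Y -> Y1 \subset Y -> Y \subset 'N(Y1) -> E \subset D -> E \subset Y1 ->
    M \subset Y1 ->
  #|Y : D <*> M| <= #|Y : D <*> Y1| * #|Y1 : E <*> M|.
Proof.
move=> nsDY sY1Y nY1Y sED sEY1 sMY1; have [sDY nDY] := andP nsDY.
have sDMY1: D <*> M \subset D <*> Y1 by rewrite genS ?setUS.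
rewrite -(Lagrange_index _ sDMY1); last by rewrite join_subG sDY.
rewrite leq_mul2l; apply/orP; right.
have -> : #|D <*> Y1 : D <*> M| = #|(D <*> M) * Y1 : D <*> M|.
  congr #|_ : _|.
  rewrite !norm_joinEr ?(subset_trans _ nDY) // ?(subset_trans sMY1) //.
  by rewrite -mulgA (mulSGid sMY1).
rewrite indexMg.
apply: dvdn_leq; first exact: indexg_gt0.
apply: indexgS.
by rewrite genS ?setSU.
Qed.

(** [gam] is ['L_3] for the class 2 bounds and the trivial subgroup for bounds on whole orders. *)
Variable gam : {group gT} -> {group gT}.
Hypothesis gamS : forall Y Y1, Y1 \subset Y -> gam Y1 \subset gam Y.
Hypothesis gam_normal : forall Y, gam Y <| Y.

(** Induction along [s]: the kernel ['C_Y(U)] of one layer is again normal in [G] and plays the role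
    of [Y] for the next, which is why the layer bound ranges over all normal [Y]. *)
Lemma index_layers G (s : seq {group gT}) (f : {group gT} -> nat) :
    {in s, forall U, G \subset 'N(U)} ->
    (forall U Y, U \in s -> Y <| G -> #|Y : gam Y <*> 'C_Y(U)| <= f U) ->
  forall Y, Y <| G ->
  #|Y : gam Y <*> 'C_Y(\bigcup_(U <- s) U)| <= \prod_(U <- s) f U.
Proof.
elim: s => [|U s IHs] nUG leUf Y nsYG.
  rewrite !big_nil.
 have ->: 'C_Y(set0) = Y.
    by apply/setIidPl/subsetP=> x _; apply/centP=> y; rewrite inE.
  by rewrite (joing_idPr _) ?indexgg // normal_sub.
rewrite !big_cons.
rewrite centU setIA.
have nsY1G: 'C_Y(U) <| G.
  rewrite -(setIidPl (normal_sub nsYG)) -setIA normalI //.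
  by rewrite /normal subsetIl normsI ?normG ?norms_cent ?nUG ?mem_head.
have sY1 := subsetIl Y 'C(U).
have leS: #|'C_Y(U) : gam ('C_Y(U)) <*> 'C_('C_Y(U))(\bigcup_(V <- s) V)|
            <= \prod_(V <- s) f V.
  apply: IHs nsY1G => [V sV|V Z sV]; first by rewrite nUG // in_cons sV orbT.
  by apply: leUf; rewrite in_cons sV orbT.
have leU := leUf U Y (mem_head _ _) nsYG.
apply: leq_trans (leq_mul leU leS).
apply: index_join_leq; rewrite ?gam_normal ?gamS ?subsetIl //.
  exact: subset_trans (normal_sub nsYG) (normal_norm nsY1G).
exact: normal_sub (gam_normal _).
Qed.

End Layers.

(** * Passing to the faithful quotient by ['C_G(V)] *)

Section FaithfulQuotient.

Variables (gT : finGroupType) (G V : {group gT}).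
Hypotheses (nVG : G \subset 'N(V)) (tiGV : G :&: V = 1).

Let C := 'C_G(V).

Lemma card_quotient_cent : #|V / C| = #|V|.
Proof.
have nCV: V \subset 'N(C) by rewrite cents_norm // centsC subsetIr.
apply/esym/card_isog/quotient_isog => //.
by apply/trivgP; rewrite -[1]tiGV /= setIAC subsetIl.
Qed.

Lemma norm_quotient_cent : G / C \subset 'N(V / C).
Proof. by rewrite quotient_norms. Qed.

(** If [X / C] centralizes [V / C], then [[~: X, V]] lies both in [G] and in [V], hence is
    trivial. *)
Lemma cent_quotient_cent : 'C_(G / C)(V / C) = 1.
Proof.
have nCV: V \subset 'N(C) by rewrite cents_norm // centsC subsetIr.
have nsCG: C <| G by rewrite /normal subsetIl normsI ?normG ?norms_cent.
have [X defX sCX sXG] := inv_quotientS nsCG (subsetIl (G / C) 'C(V / C)).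
rewrite /= in defX; rewrite defX; apply: quotientS1; rewrite subsetI sXG /=.
have nCX := subset_trans sXG (normal_norm nsCG).
have: X / C \subset 'C(V / C) by rewrite -defX subsetIr.
rewrite quotient_cents2 // => sRC; apply/commG1P/trivgP.
rewrite -tiGV subsetI (subset_trans sRC) ?subsetIl //=.
by rewrite commg_subr (subset_trans sXG).
Qed.

Lemma index_quotient_cent n :
  #|G / C : 'L_n(G / C)| = #|G : 'L_n(G) <*> C|.
Proof.
have nsCG: C <| G by rewrite /normal subsetIl normsI ?normG ?norms_cent.
have [sCG nCG] := andP nsCG.
have sLN: 'L_n(G) \subset 'N(C) by rewrite (subset_trans (lcn_sub _ _)).
rewrite -morphim_lcn // -/(quotient _ _).
rewrite -['L_n(G) / C](quotientYidr sLN) index_quotient_eq //.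
  by rewrite (subset_trans (subsetIr _ _)) // joing_subr.
by rewrite join_subG lcn_sub.
Qed.

End FaithfulQuotient.

(** The derived subgroup is generated by [x ^+ 2], which [y] inverts, so ['L_3(G)] contains
    [x ^+ 4], while [<[x]>] has index 2. *)
Lemma extremal2_index_lcn3 (gT : finGroupType) (G : {group gT}) :
  extremal2 G -> #|G : 'L_3(G)| <= 8.
Proof.
move=> extG; have bound n x y : n > 1 -> extremal_generators G 2 n (x, y) ->
    (extremal_class G == SemiDihedral) ==> (#[y] == 2) -> #|G : 'L_3(G)| <= 8.
  move=> n_gt1 genG oy; have [oG Gx ox /setDP[Gy nXy]] := genG.
  have [[_ _ _ conjX] [defG' _ _ _] _ _ _] := extremal2_structure genG extG oy.
  have oG2: #|G| = (2 * #[x])%N by rewrite oG ox -expnS prednK // ltnW.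
  have Lx4: x ^- 4 \in 'L_3(G).
    have: [~ x ^+ 2, y] \in 'L_3(G).
      by rewrite lcnSn mem_commg // lcn2 defG' cycle_id.
    rewrite commgEl conjX ?mem_cycle ?inE ?nXy //.
    case: ifP => _; last by rewrite -invMg -expgD.
    (* In the semidihedral case [y] acts on [<[x]>] as the power [r.-1]; on [x ^+ 2] this is
       inversion because [#[x] = 2 * r]. *)
    set r := (2 ^ n.-2)%N; have r_gt0: 0 < r by rewrite expn_gt0.
    have ->: x ^+ 2 ^+ r.-1 = x ^- 2; last by rewrite -invMg -expgD.
    apply: (mulgI (x ^+ 2)); rewrite mulgV -expgS prednK // -expgM -expnS.
    by rewrite -[n.-2.+1]/(n.-1.-1.+1) prednK ?expg_order -?ox ?expg_order //; lia.
  have sXL: <[x ^+ 4]> \subset 'L_3(G) by rewrite cycle_subG -groupV.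
  apply: leq_trans (dvdn_leq (indexg_gt0 _ _) (indexgS G sXL)) _.
  rewrite -(leq_pmul2l (order_gt0 (x ^+ 4))) Lagrange ?cycle_subG ?groupX //.
  rewrite oG2 (_ : _ * 8 = 2 * (4 * #[x ^+ 4]))%N; last by lia.
  rewrite leq_mul2l /= dvdn_leq ?muln_gt0 ?order_gt0 //.
  by rewrite order_dvdn expgM expg_order.
have: extremal_class G \in behead enum_extremal_groups by [].
rewrite !inE => /or3P[] /eqP cG.
- have [n n_gt1 isoG] := (dihedral_classP G).1 cG.
  have [[x y] genG _] := generators_2dihedral n_gt1 isoG.
  by apply: bound genG _; rewrite ?cG.
- have [n n_gt3 isoG] := (semidihedral_classP G).1 cG.
  have [[x y] genG [/eqP oy _]] := generators_semidihedral n_gt3 isoG.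
  by apply: bound genG _; rewrite ?oy ?implybT //; lia.
have [n n_gt2 isoG] := (quaternion_classP G).1 cG.
have [[x y] genG _] := generators_quaternion n_gt2 isoG.
by apply: bound genG _; rewrite ?cG //; lia.
Qed.

Lemma dprod_index_lcn (gT : finGroupType) n (G S T : {group gT}) :
  S \x T = G ->
  #|G : 'L_n(G)| = (#|S : 'L_n(S)| * #|T : 'L_n(T)|)%N.
Proof.
move=> defG; have oG := dprod_card defG; have oL := dprod_card (lcn_dprod n defG).
apply/eqP; rewrite -(eqn_pmul2l (cardG_gt0 'L_n(G))) Lagrange ?lcn_sub //.
by rewrite -oL mulnACA !Lagrange ?lcn_sub // oG.
Qed.

(** * Faithful irreducible actions *)

Section Irreducible.

Variables (gT : finGroupType) (G V : {group gT}).
Hypotheses (minV : minnormal V G) (cGV1 : 'C_G(V) = 1).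

Let nVG : G \subset 'N(V).
Proof. by have /andP[] := mingroupp minV. Qed.

Let ntV : V :!=: 1.
Proof. by have /andP[] := mingroupp minV. Qed.

Lemma minnormal_cent_normal (Y : {group gT}) :
  Y <| G -> Y :!=: 1 -> 'C_V(Y) = 1.
Proof.
move=> /andP[sYG nYG] ntY; apply: contraNeq ntY => ntC.
have [_ minVG] := mingroupP minV.
have defC: 'C_V(Y) = V.
  by apply: minVG; rewrite ?subsetIl // ntC normsI ?norms_cent.
rewrite -subG1 -cGV1 subsetI sYG centsC -defC; exact: subsetIr.
Qed.

Lemma minnormal_cent_central x :
  x \in 'Z(G) -> x != 1 -> 'C_V[x] = 1.
Proof.
case/centerP=> Gx cGx ntx; rewrite -cent_cycle minnormal_cent_normal //.
  rewrite /normal cycle_subG Gx cents_norm // centsC cycle_subG.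
  by apply/centP=> y /cGx.
by rewrite cycle_eq1.
Qed.

(** A nontrivial [x] has a power of prime order; being central, that power has no nontrivial fixed
    point, and it fixes whatever [x] fixes. *)
Lemma semiregular_central_prime :
    {in G, forall x, prime #[x] -> x \in 'Z(G)} ->
  semiregular V G.
Proof.
move=> ZG x /setD1P[ntx Gx]; have p_pr: prime (pdiv #[x]).
  by rewrite pdiv_prime // ltn_neqAle eq_sym order_eq1 ntx order_gt0.
have o_y: #[x ^+ (#[x] %/ pdiv #[x])] = pdiv #[x].
  by rewrite orderXdiv ?dvdn_div ?pdiv_dvd // divnA ?pdiv_dvd // mulKn.
set y := x ^+ _ in o_y.
have Zy: y \in 'Z(G) by rewrite ZG ?groupX // o_y.
have nty: y != 1 by rewrite -order_eq1 o_y neq_ltn prime_gt1 ?orbT.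
apply/trivgP; rewrite -[1](minnormal_cent_central Zy nty) setIS //.
apply/subsetP=> z /cent1P cxz; apply/cent1P; exact/commuteX.
Qed.

Lemma semiregular_card_lt : semiregular V G -> #|G| < #|V|.
Proof.
move=> regG; rewrite -(ltn_predK (cardG_gt0 V)) ltnS dvdn_leq //.
  by rewrite -subn1 subn_gt0 cardG_gt1.
exact: regular_norm_dvd_pred.
Qed.

End Irreducible.

(** The product [v * v ^ u] is fixed by [u]. *)
Lemma invol_inverts (gT : finGroupType) (V : {group gT}) u :
    abelian V -> u \in 'N(V) -> #[u] = 2 -> 'C_V[u] = 1 ->
  {in V, forall v, v ^ u = v^-1}.
Proof.
move=> /centsP abV nVu ou C1 v Vv; have Vvu: v ^ u \in V by rewrite memJ_norm.
apply/eqP; rewrite eq_sym eq_invg_mul; apply/eqP/set1P; rewrite -[[set 1]]C1 inE groupM //=.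
apply/cent1P/commgP/conjg_fixP; rewrite conjMg -conjgM.
by rewrite -[u * u]/(u ^+ 2) -ou expg_order conjg1 abV.
Qed.

(** Inversion commutes with every automorphism of [V], so [[~ u, g]] acts trivially. *)
Lemma invert_central (gT : finGroupType) (G V : {group gT}) u :
    G \subset 'N(V) -> 'C_G(V) = 1 -> u \in G ->
    {in V, forall v, v ^ u = v^-1} -> u \in 'Z(G).
Proof.
move=> nVG CGV1 Gu invu; apply/centerP; split=> // g Gg.
suff: [~ u, g] \in 'C_G(V) by rewrite CGV1 => /set1P/eqP/commgP.
rewrite inE groupR //=; apply/centP=> v Vv.
apply/esym/commgP/conjg_fixP; rewrite commgEl conjgM.
have uV w: w \in V -> w ^ u^-1 = w^-1.
  by move=> Vw; rewrite -{1}[w]invgK -(invu w^-1) ?groupV // conjgK.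
have ng w y: w \in V -> y \in G -> w ^ y \in V.
  by move=> Vw Gy; rewrite memJ_norm ?(subsetP nVG).
by rewrite (uV _ Vv) (conjgE u) !conjgM (invu (v^-1 ^ g^-1)) ?ng ?groupV // !conjVg invgK conjgKV.
Qed.

(** * Nilpotent groups of normal rank one *)

(** The quotient of the even number [m.-1] by the odd [n] is even and nonzero. *)
Lemma odd_dvd_pred_bound m n :
  odd m -> odd n -> 1 < m -> n %| m.-1 -> (2 * n).+1 <= m.
Proof.
case: m => [|m] // odd_m odd_n m_gt0 /dvdnP[k /= def_m].
rewrite ltnS def_m leq_mul2r; apply/orP; right.
by case: k def_m odd_m m_gt0 => [|[|k]] //= ->; rewrite ?mul0n ?mul1n ?odd_n.
Qed.

(** The square of [2 * t + 1] exceeds [8 * t] by the square of [2 * t - 1]. *)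
Lemma mul8_lt_sqr (t m n r c : nat) : 0 < t -> m <= 8 -> n <= t ->
  (2 * t).+1 <= r -> (2 * t).+1 <= c -> m * n < r * c.
Proof.
move=> t_gt0 le8 le_nt ler lec; apply: leq_trans (leq_mul ler lec).
by apply: leq_ltn_trans (leq_mul le8 le_nt) _; nia.
Qed.

(** If all elements of prime order are central, [G] acts semiregularly. Otherwise ['O_2^'(G)] is
    cyclic and central, ['O_2(G)] is extremal and [u] is an involution. With [t] the order of
    ['O_2^'(G)], the index is at most [8 * t], while [[~: V, <[u]>]] and ['C_V(<[u]>)] each have at
    least [2 * t + 1] elements. *)
Lemma rank1_class2_bound (gT : finGroupType) (G V : {group gT}) :
    nilpotent G -> abelian V -> coprime #|V| #|G| -> minnormal V G ->
    'C_G(V) = 1 ->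
    (forall (q : nat) (X : {group gT}), X <| 'O_q(G) -> abelian X -> cyclic X) ->
  #|G : 'L_3(G)| < #|V|.
Proof.
move=> nilG abV coVG minV cGV1 rank1G.
have [ntV nVG] := andP (mingroupp minV).
have leLG: #|G : 'L_3(G)| <= #|G|.
  by rewrite -(Lagrange (lcn_sub 3 G)) leq_pmull.
have [/forall_inP ZG | ] :=
  boolP [forall x in G, prime #[x] ==> (x \in 'Z(G))].
  apply: leq_ltn_trans leLG (semiregular_card_lt minV _).
  by apply: semiregular_central_prime => // x Gx; apply/implyP/ZG.
case/forall_inPn=> u Gu; rewrite negb_imply => /andP[pr_u nZu].
have cycO (q : nat) : cyclic 'O_q(G) \/ [/\ q = 2 & extremal2 'O_q(G)].
  have [|cO|/and3P[/eqP q2 eO _]] := normal_rank1_structure (pcore_pgroup q G).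
  - by move=> X; apply: rank1G.
  - by left.
  by right.
have cycT: cyclic 'O_2^'(G).
  apply: nil_Zgroup_cyclic; last exact: nilpotentS (pcore_sub _ _) nilG.
  apply/forall_inP=> P /SylowP[q q_pr sylP].
  have nilT: nilpotent 'O_2^'(G) := nilpotentS (pcore_sub _ _) nilG.
  have [q2 | q'2] := eqVneq q 2.
    have /(pnat_1 (pHall_pgroup sylP)): q^'.-group P.
      by rewrite q2; apply: pgroupS (pHall_sub sylP) (pcore_pgroup _ _).
    by move=> P1; rewrite (card1_trivg P1) cyclic1.
  have [cO|[/eqP]] := cycO q; last by rewrite (negPf q'2).
  apply: cyclicS cO; rewrite (nilpotent_Hall_pcore nilT sylP).
  by rewrite pcore_max ?pcore_pgroup ?gFnormal_trans ?pcore_normal.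
have defG := nilpotent_pcoreC 2 nilG.
have [_ defG' cST tiST] := dprodP defG.
have ZT: 'O_2^'(G) \subset 'Z(G).
  rewrite subsetI pcore_sub /= centsC -{1}defG' mul_subG //.
    by rewrite centsC.
  exact: cyclic_abelian.
have ntO2: ~ cyclic 'O_2(G).
  move=> cO2; case/negP: nZu; rewrite (subsetP _ u Gu) // subsetI subxx.
  rewrite -{1}defG' mul_subG //; last exact: subset_trans ZT (subsetIr _ _).
  suff: 'O_2(G) \subset 'C('O_2(G) * 'O_2^'(G)) by rewrite defG'.
  by rewrite centM subsetI -abelianE cyclic_abelian //= centsC.
have [// | [_ extG]] := cycO 2.
have ou: #[u] = 2.
  have [//|ou] := eqVneq #[u] 2; case/negP: nZu; apply: (subsetP ZT).
  have hallT := nilpotent_pcore_Hall 2^' nilG.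
  rewrite (mem_normal_Hall hallT) ?pcore_normal //.
  by rewrite /p_elt pnatE // !inE.
have nVu: u \in 'N(V) := subsetP nVG u Gu.
have coVu: coprime #|V| #|<[u]>| by rewrite (coprimegS _ coVG) ?cycle_subG.
have oV := coprime_abel_card (_ : <[u]> \subset 'N(V)) coVu abV.
rewrite cycle_subG in oV; move/(_ nVu): oV => oV.
have oddV: odd #|V|.
  by rewrite -coprimen2 -ou.
have regT (U : {group gT}) : U \subset V -> 'O_2^'(G) \subset 'N(U) ->
    U :!=: 1 -> (2 * #|'O_2^'(G)|).+1 <= #|U|.
  move=> sUV nUT ntU; have regUT: semiregular U 'O_2^'(G).
    move=> x /setD1P[ntx Tx]; have Zx := subsetP ZT x Tx.
    apply/trivgP; apply: subset_trans (setSI _ sUV) _.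
    by rewrite (minnormal_cent_central minV cGV1 Zx ntx).
  apply: odd_dvd_pred_bound; last exact: regular_norm_dvd_pred nUT regUT.
  - exact: oddSg sUV oddV.
  - by rewrite odd_2'nat; apply: pcore_pgroup.
  by rewrite cardG_gt1.
have cTu: 'O_2^'(G) \subset 'C(<[u]>).
  rewrite centsC cycle_subG; apply: subsetP Gu.
  by rewrite centsC (subset_trans ZT) ?subsetIr.
have nVT: 'O_2^'(G) \subset 'N(V) := subset_trans (pcore_sub _ _) nVG.
have leR: (2 * #|'O_2^'(G)|).+1 <= #|[~: V, <[u]>]|.
  apply: regT; rewrite ?commg_subl ?cycle_subG ?normsR // ?cents_norm //.
  apply: contraNneq nZu => /commG1P; rewrite centsC cycle_subG => cVu.
  suff /set1P->: u \in [1 gT] by rewrite group1.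
  by rewrite -cGV1 inE Gu.
(* Without nontrivial fixed points [u] would invert [V] and so be central. *)
have leC: (2 * #|'O_2^'(G)|).+1 <= #|'C_V(<[u]>)|.
  apply: regT; rewrite ?subsetIl ?normsI ?norms_cent // ?cents_norm //.
  apply: contraNneq nZu => /= C1.
  apply: invert_central nVG cGV1 Gu (invol_inverts abV nVu ou _).
  by rewrite -cent_cycle.
have oT := cardG_gt0 'O_2^'(G).
have le8 := extremal2_index_lcn3 extG.
have leT: #|'O_2^'(G) : 'L_3('O_2^'(G))| <= #|'O_2^'(G)|.
  by rewrite -[leqRHS](Lagrange (lcn_sub 3 'O_2^'(G))) leq_pmull.
have := mul8_lt_sqr oT le8 leT leR leC.
rewrite oV.
by rewrite -(dprod_index_lcn 3 defG).
Qed.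

(** * Block decompositions *)

Section Trace.

Import GRing.Theory FiniteModule.
Local Open Scope ring_scope.

Variables (gT : finGroupType) (V : {group gT}) (abV : abelian V).

(** Applying [b] permutes the summands cyclically, so the sum is a fixed point of [b]. *)
Lemma sum_actr_fix0 (b : gT) q (u : fmod_of abV) :
    b \in 'N(V) -> (b ^+ q = 1)%g -> ('C_V[b] = 1)%g ->
  \sum_(i < q) u ^@ (b ^+ i)%g = 0.
Proof.
move=> Nb bq1 C1; set s := \sum_(i < q) _.
have sb: s ^@ b = s.
  rewrite actr_sum /s; case: q bq1 @s => [|q] bq1 s; first by rewrite !big_ord0.
  rewrite big_ord_recr big_ord_recl /= addrC; congr (_ + _).
    by rewrite -actrM ?groupX // -expgSr bq1.
  apply: eq_bigr => i _; rewrite -actrM ?groupX // -expgSr.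
  by rewrite /bump /= add1n.
have: val s \in 'C_V[b]%g.
  rewrite inE fmodP /=; apply/cent1P/commgP/conjg_fixP.
  by rewrite -fmvalJ ?sb.
by rewrite C1 => /set1P s1; apply: val_inj; rewrite /= fmval0.
Qed.

End Trace.

(* Otherwise the orbit sum of [u] under each [<y * z ^+ i>] vanishes; adding these
   [q] sums, the terms off the diagonal regroup into orbit sums of [z], which
   vanish too, and [q u = 0] remains. *)
Lemma coprime_rank2_fix (gT : finGroupType) (V : {group gT}) q (y z : gT) :
    abelian V -> V :!=: 1 -> prime q -> q^'.-group V ->
    y \in 'N(V) -> z \in 'N(V) -> commute y z -> y ^+ q = 1 -> z ^+ q = 1 ->
    'C_V[z] = 1 -> 
  exists i, 'C_V[y * z ^+ i] != 1.
Proof.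
move=> abV ntV q_pr q'V Ny Nz cyz yq zq Cz1.
suff /exists_inP[i _ Ci]: [exists i : 'I_q, true && ('C_V[y * z ^+ i] != 1)].
  by exists i.
apply: contraR ntV; rewrite negb_exists => /forallP/= C1.
rewrite -subG1; apply/subsetP=> v Vv.
pose u := FiniteModule.fmod abV v.
have uq: (u *+ q = 0)%R.
  have S0 (i : 'I_q) :
      (\sum_(j < q) FiniteModule.actr u ((y * z ^+ i) ^+ j)%g = 0)%R.
    apply: sum_actr_fix0; rewrite ?groupM ?groupX //; last exact/eqP/negPn.
    by rewrite expgMn ?yq -?expgM 1?mulnC ?expgM ?zq ?expg1n ?mulg1 //; apply: commuteX.
  have: (\sum_(i < q) \sum_(j < q) FiniteModule.actr u ((y * z ^+ i) ^+ j)%g = 0)%R.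
    by apply: big1 => i _.
  rewrite exchange_big (bigD1 (Ordinal (prime_gt0 q_pr))) //=.
  rewrite [X in (_ + X)%R]big1 ?GRing.addr0 => [|j ntj].
    by rewrite (eq_bigr (fun _ => u)) ?GRing.sumr_const ?card_ord // => i _; rewrite FiniteModule.actr1.
  have zqj: coprime #[z] j.
    have dvz: #[z] %| q by rewrite order_dvdn zq.
    apply: coprime_dvdl dvz _; rewrite prime_coprime //.
    apply: contra ntj => qj; rewrite -val_eqE /= -leqn0 leqNgt.
    by apply/negP=> /dvdn_leq/(_ qj); rewrite leqNgt ltn_ord.
  have Cj: 'C_V[z ^+ j] = 1.
    suff: 'C_V[z ^+ j] \subset 'C_V[z] by rewrite Cz1 => /trivgP.
    apply/setIS/subsetP=> x /cent1P cxz; apply/cent1P.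
    by rewrite -(expgK zqj (cycle_id z)); apply: commuteX.
  have zjq: (z ^+ j) ^+ q = 1 by rewrite -expgM mulnC expgM zq expg1n.
  rewrite -[RHS](sum_actr_fix0 (FiniteModule.actr u (y ^+ j)) (groupX j Nz) zjq Cj).
  apply: eq_bigr => i _; rewrite -FiniteModule.actrM ?groupX //.
  by rewrite expgMn -?expgM 1?[(i * j)%N]mulnC //; apply: commuteX.
have vq: v ^+ q = 1.
  by rewrite -(FiniteModule.fmodK abV Vv) -FiniteModule.fmvalZ uq.
rewrite inE -order_eq1 -dvdn1; have: coprime #[v] q.
  rewrite coprime_sym prime_coprime // -p'natE //; exact: mem_p_elt q'V Vv.
by move/eqP <-; rewrite dvdn_gcd dvdnn order_dvdn vq /=.
Qed.

(* [V] is the direct product of the [q] conjugates of [V0] under [G], which is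
   permuted cyclically by [t] with [K] as the kernel of the permutation action,
   and [V1] is the product of the conjugates other than [V0]. *)
Record blocks (gT : finGroupType) (G V : {group gT}) (q : nat)
    (K V0 V1 : {group gT}) (t : gT) : Prop := Blocks {
  bl_norm : K <| G;
  bl_index : #|G : K| = q;
  bl_t : t \in G :\: K;
  bl_sub : V0 \subset V;
  bl_nV0 : K \subset 'N(V0);
  bl_nV1 : K \subset 'N(V1);
  bl_irr : forall U : {group gT},
    U \subset V0 -> U :!=: 1 -> K \subset 'N(U) -> U :=: V0;
  bl_conj : {in G :\: K, forall x, V0 :^ x \subset V1};
  bl_mul : V0 * V1 = V;
  bl_card : #|V| = (#|V0| ^ q)%N;
  bl_gen : V \subset <<\bigcup_(i < q) V0 :^ (t ^+ i)>>;
  bl_gen1 : V1 \subset <<\bigcup_(i < q.-1) V0 :^ (t ^+ i.+1)>>;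
  bl_lt : q < #|V0|
}.

Lemma rank2_normal_elem (gT : finGroupType) (G : {group gT}) (q : nat)
    (X : {group gT}) :
    nilpotent G -> X <| 'O_q(G) -> abelian X -> ~~ cyclic X ->
  [/\ prime q & exists E : {group gT},
      [/\ E <| G, q.-abelem E & #|E| = (q ^ 2)%N]].
Proof.
move=> nilG nsXO abX ncX; have qO := pcore_pgroup q G.
have qX := pgroupS (normal_sub nsXO) qO.
have ntX: X :!=: 1 by apply: contraNneq ncX => ->; apply: cyclic1.
have [q_pr _ _] := pgroup_pdiv qX ntX; split=> //.
have nsX1O: 'Ohm_1(X) <| 'O_q(G) by apply: gFnormal_trans.
have abX1: q.-abelem 'Ohm_1(X) := Ohm1_abelem qX abX.
have [|E [sEX1 nsEO oE]] := @normal_pgroup q gT 2 _ _ qO nsX1O.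
  by rewrite -p_rank_abelian // -(rank_pgroup qX) ltnNge -abelian_rank1_cyclic.
exists E; split=> //; last exact: abelemS sEX1 abX1.
have [_ defG cST _] := dprodP (nilpotent_pcoreC q nilG).
have sEO := normal_sub nsEO.
rewrite /normal (subset_trans sEO (pcore_sub _ _)) -{1}defG mul_subG //.
  exact: normal_norm.
by rewrite cents_norm // (subset_trans cST) ?centS.
Qed.

Section PrimeIndex.

Variables (gT : finGroupType) (G K : {group gT}) (t : gT).
Hypotheses (nsKG : K <| G) (prGK : prime #|G : K|) (tGK : t \in G :\: K).

Lemma order_coset_prime_index : #[coset K t] = #|G : K|.
Proof.
case/setDP: tGK => Gt nKt; have Nt := subsetP (normal_norm nsKG) t Gt.
apply/eqP; move: (prGK); rewrite -card_quotient ?normal_norm // => pr.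
have: #[coset K t] %| #|G / K| by rewrite order_dvdG ?mem_quotient.
case/primeP: pr => _ dv /dv /orP[|//].
by rewrite order_eq1 => /eqP/(coset_idr Nt); rewrite (negPf nKt).
Qed.

Lemma expg_prime_index i : 0 < i < #|G : K| -> t ^+ i \in G :\: K.
Proof.
case/setDP: tGK => Gt nKt; have Nt := subsetP (normal_norm nsKG) t Gt.
case/andP=> i_gt0 lti; apply/setDP; split; first exact: groupX.
apply: contraL lti => Kti; rewrite -leqNgt dvdn_leq //.
by rewrite -order_coset_prime_index order_dvdn -morphX //= coset_id.
Qed.

Lemma rcoset_prime_index x :
  x \in G -> exists2 i, i < #|G : K| & x * t ^- i \in K.
Proof.
case/setDP: tGK => Gt nKt Gx; have Nt := subsetP (normal_norm nsKG) t Gt.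
have Nx := subsetP (normal_norm nsKG) x Gx.
have defGK: G / K = <[coset K t]>.
  apply/esym/eqP; rewrite eqEcard cycle_subG mem_quotient //=.
  by rewrite card_quotient ?normal_norm // -orderE order_coset_prime_index.
have: coset K x \in <[coset K t]> by rewrite -defGK mem_quotient.
case/cyclePmin=> i; rewrite order_coset_prime_index => lti cx; exists i => //.
apply: coset_idr; first by rewrite groupM ?groupV ?groupX.
by rewrite morphM ?groupV ?groupX //= morphV ?groupX //= cx morphX //= mulgV.
Qed.

End PrimeIndex.

(* [G] has a normal elementary abelian subgroup [E] of order [q ^ 2], generated by
   a central [z] and a noncentral [b] with [C_V(b) != 1]; take [K = C_G(b)],
   [V0 = C_V(b)] and [V1 = [V, b]]. *)
Lemma blocks_exist (gT : finGroupType) (G V : {group gT}) (q : nat)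
    (X : {group gT}) :
    nilpotent G -> abelian V -> coprime #|V| #|G| -> minnormal V G ->
    'C_G(V) = 1 -> X <| 'O_q(G) -> abelian X -> ~~ cyclic X ->
  prime q /\ exists K V0 V1 t,
    blocks G V q K V0 V1 t /\ 'O_q^'(G) \subset K.
Proof.
move=> nilG abV coVG minV cGV1 nsXO abX ncX.
have [ntV nVG] := andP (mingroupp minV).
have [q_pr [E [nsEG abelE oE]]] := rank2_normal_elem nilG nsXO abX ncX.
split=> //; have [sEG nEG] := andP nsEG; have abE := abelem_abelian abelE.
have [_ expE] := abelemP q_pr abelE.
have oEy y : y \in E -> y != 1 -> #[y] = q by move=> Ey; apply: abelem_order_p abelE _.
have ntE: E :!=: 1.
  by rewrite -cardG_gt1 oE -(expn0 q) ltn_exp2l ?prime_gt1.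
have sZE := meet_center_nil nilG nsEG ntE.
have [z /setIP[Ez Zz] ntz] := trivgPn _ sZE.
have Cz1 : 'C_V[z] = 1 := minnormal_cent_central minV cGV1 Zz ntz.
have /centerP[Gz cGz] := Zz.
have oz := oEy z Ez ntz.
have q'V: q^'.-group V.
  rewrite /pgroup p'natE // -prime_coprime // coprime_sym.
  by apply: coprime_dvdr coVG; rewrite -oz order_dvdG.
have [y Ey nzy]: exists2 y, y \in E & y \notin <[z]>.
  apply/subsetPn; apply/negP=> /subset_leq_card.
  by rewrite oE -orderE oz leqNgt -[ltnLHS]expn1 ltn_exp2l ?prime_gt1.
have Ny x : x \in E -> x \in 'N(V) by move/(subsetP sEG)/(subsetP nVG).
have [i0 ntCb] := coprime_rank2_fix abV ntV q_pr q'V (Ny y Ey) (Ny z Ez)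
  (centsP abE y Ey z Ez) (expE y Ey) (expE z Ez) Cz1.
set b := y * z ^+ i0 in ntCb.
have Eb: b \in E by rewrite groupM ?groupX.
have nzb: b \notin <[z]> by rewrite groupMr // mem_cycle.
have Gb := subsetP sEG b Eb.
have ntb: b != 1 by apply: contraNneq nzb => ->; apply: group1.
have ob := oEy b Eb ntb.
have defM x (Ex : x \in E) : x != 1 -> x \notin <[z]> -> <[x]> * <[z]> = E.
  move=> ntx nzx; apply/eqP; rewrite eqEcard mul_subG ?cycle_subG //= oE.
  rewrite TI_cardMg -?orderE ?oz ?oEy //.
  by rewrite prime_TIg ?cycle_subG // -orderE oEy.
have defE := defM b Eb ntb nzb.
have nZb: b \notin 'Z(G).
  by apply: contra ntCb => Zb; rewrite (minnormal_cent_central minV cGV1 Zb ntb).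
(* A nontrivial [[~: E, G]] contains a central [x != 1]. If [x] were outside [<[z]>], then [E] and
   hence [b] would be central; so [<[x]> = <[z]>]. A further element outside it would give
   [[~: E, G] = E], impossible by nilpotence. *)
have sRz: [~: E, G] \subset <[z]>.
  have nER: G \subset 'N([~: E, G]) by apply: commg_normr.
  have sRE: [~: E, G] \subset E by rewrite commg_subl.
  have [R1 | ntR] := eqsVneq [~: E, G] 1; first by rewrite R1 sub1G.
  have nsRG: [~: E, G] <| G by rewrite /normal (subset_trans sRE).
  have [x /setIP[Rx Zx] ntx] := trivgPn _ (meet_center_nil nilG nsRG ntR).
  have Ex := subsetP sRE x Rx.
  have [zx | nzx] := boolP (x \in <[z]>); last first.
    case/negP: nZb; rewrite (subsetP _ b Eb) // -(defM x Ex ntx nzx).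
    by rewrite mul_subG ?cycle_subG.
  have defz: <[x]> = <[z]>.
    by apply/eqP; rewrite eqEcard cycle_subG zx -!orderE oz (oEy x Ex ntx) /=.
  rewrite -defz; apply/idPn=> nRx.
  have /properP[_ [r Er nRr]]: [~: E, G] \proper E.
    by rewrite (nil_comm_properl nilG) // subsetI subxx.
  have [s Rs nxs] := subsetPn nRx; have Es := subsetP sRE s Rs.
  have nts: s != 1 by apply: contraNneq nxs => ->; apply: group1.
  have sER: <[s]> * <[x]> \subset [~: E, G] by rewrite mul_subG ?cycle_subG.
  by rewrite defz defM -?defz // in sER; rewrite (subsetP sER) in nRr.
have cGzb x : x \in G -> b ^ x \in b *: <[z]>.
  by move=> Gx; rewrite mem_lcoset -commgEl (subsetP sRz) ?mem_commg.
pose K := 'C_G[b]; pose V0 := 'C_V[b]; pose V1 := [~: V, <[b]>].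
have sGz: G \subset 'C[z] by apply/subsetP=> x Gx; apply/cent1P; apply/esym/cGz.
have defK: K = 'C_G(E).
  rewrite -defE centM !cent_cycle setIA /K.
  by apply/esym/setIidPl; rewrite subIset // sGz.
have nsKG: K <| G by rewrite defK /normal subsetIl normsI ?normG ?norms_cent.
have sTK: 'O_q^'(G) \subset K.
  have [_ _ cST _] := dprodP (nilpotent_pcoreC q nilG).
  rewrite defK subsetI pcore_sub /= (subset_trans cST) ?centS //.
  by rewrite pcore_max ?(abelem_pgroup abelE).
(* The conjugates of [b] lie in the coset [b *: <[z]>], so the index is at most [q]; it is a power
   of [q] since ['O_q^'(G)] lies in [K], and is not 1 since [b] is not central. *)
have iK: #|G : K| = q.
  apply/eqP; rewrite eqn_leq; apply/andP; split.
    rewrite index_cent1 -oz orderE -(card_lcoset <[z]> b) subset_leq_card //.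
    by apply/subsetP=> _ /imsetP[x Gx ->]; apply: cGzb.
  have qGK: q.-nat #|G : K|.
    have [hT _ _] := and3P (nilpotent_pcore_Hall q^' nilG).
    apply: pnat_dvd (indexgS G sTK) _; have := nilpotent_pcore_Hall q^' nilG.
    by case/and3P=> _ _; rewrite pnatNK.
  have [[|m] oGK] := p_natP qGK; last first.
    by rewrite oGK -[leqLHS]expn1 leq_exp2l ?prime_gt1.
  case/negP: nZb; apply/centerP; split=> // x Gx.
  suff: x \in K by case/setIP=> _ /cent1P.
  by apply: subsetP Gx; rewrite -indexg_eq1 oGK.
have sKG: K \subset G := subsetIl _ _.
have nV0K: K \subset 'N(V0).
  apply: normsI; first exact: subset_trans nVG.
  exact: subset_trans (subsetIr _ _) (normG _).
have nbK: K \subset 'N(<[b]>) by rewrite cents_norm // cent_cycle subsetIr.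
have nV1K: K \subset 'N(V1) by rewrite normsR // (subset_trans sKG).
have coVb: coprime #|V| #|<[b]>| by rewrite (coprimegS _ coVG) ?cycle_subG.
have nVb: <[b]> \subset 'N(V) by rewrite cycle_subG Ny.
have sV0V: V0 \subset V := subsetIl _ _.
have sV1V: V1 \subset V by rewrite commg_subl.
have defV0: V0 = 'C_V(<[b]>) by rewrite cent_cycle.
have tiV01: V0 :&: V1 = 1.
  have tiC := coprime_abel_cent_TI nVb coVb abV.
  by rewrite defV0 setIAC (setIidPr sV1V).
have mulV01: V0 * V1 = V.
  rewrite -[RHS](coprime_comm_cent_mul nVb coVb (abelian_sol abV)).
  by rewrite defV0; apply: centC; apply: centSS abV; rewrite ?subsetIl.
have oV: (#|V0| * #|V1|)%N = #|V| by rewrite -mulV01 TI_cardMg.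
(* A fixed point of [b] in [V0 :^ x] is fixed by [b] and [b ^ x], hence by the nontrivial central
   [[~ b, x]]. So there is none but 1, and [V0 :^ x] equals its commutator with [b]. *)
have V0conj x : x \in G :\: K -> V0 :^ x \subset V1.
  case/setDP=> Gx nKx; have nVx := subsetP nVG x Gx.
  have Ebx: b ^ x \in E by rewrite memJ_norm ?(subsetP nEG).
  have Zbx: [~ b, x] \in 'Z(G).
    have: [~ b, x] \in <[z]> by rewrite (subsetP sRz) ?mem_commg.
    by apply: subsetP; rewrite cycle_subG.
  have ntbx: [~ b, x] != 1.
    by apply: contra nKx => /commgP cbx; rewrite inE Gx; apply/cent1P/esym.
  have defV0x: V0 :^ x = 'C_V[b ^ x] by rewrite /V0 conjIg (normP nVx) cent1J.
  have nEV0x: <[b]> \subset 'N(V0 :^ x).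
    rewrite defV0x normsI // cycle_subG.
    by apply: subsetP (normG _) _ _; apply/cent1P/(centsP abE).
  have sVxV: V0 :^ x \subset V by rewrite -(normP nVx) conjSg.
  have co0: coprime #|V0 :^ x| #|<[b]>| := coprimeSg sVxV coVb.
  have ab0: abelian (V0 :^ x) := abelianS sVxV abV.
  rewrite -(coprime_comm_cent_mul nEV0x co0 (abelian_sol ab0)).
  rewrite [X in _ * X](_ : _ = 1) ?mulg1 ?commSg //; apply/trivgP/subsetP=> w.
  rewrite /= cent_cycle => /setIP[V0xw cwb].
  have: w \in 'C_V[b ^ x] by rewrite -defV0x.
  case/setIP=> Vw cwbx.
  rewrite -(minnormal_cent_central minV cGV1 Zbx ntbx) inE Vw commgEl.
  by rewrite cent1C groupM ?groupV // cent1C.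
pose CS (A : {set gT}) := <<class_support A G>>.
have nCS A : G \subset 'N(CS A) by apply/norms_gen/normsP/class_supportGidr.
have genV (U : {group gT}) : U \subset V0 -> U :!=: 1 -> CS U = V.
  move=> sU0 ntU; have [_ minVG] := mingroupP minV.
  apply: minVG; last first.
    rewrite gen_subG class_supportEr; apply/bigcupsP=> x Gx.
    by rewrite -(normP (subsetP nVG x Gx)) conjSg (subset_trans sU0).
  rewrite nCS andbT; apply: contraNneq ntU => C1; rewrite -subG1.
  by have sU: U \subset CS U; [rewrite sub_gen ?sub_class_support | rewrite /CS C1 in sU].
(* The conjugates of [U] generate [V], and each is [U] itself or lies in [V1]; thus [V] lies in
   [U <*> V1], and orders are compared with [V0 * V1]. *)
have irrV0 (U : {group gT}) :
    U \subset V0 -> U :!=: 1 -> K \subset 'N(U) -> U :=: V0.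
  move=> sU0 ntU nUK; apply/eqP; rewrite eqEcard sU0 /=.
  rewrite -(leq_pmul2r (cardG_gt0 [group of V1])) /= oV.
  have sUV := subset_trans sU0 sV0V.
  have nUV1: V1 \subset 'N(U).
    by rewrite (subset_trans sV1V) // sub_abelian_norm.
  apply: leq_trans (_ : #|U <*> V1| <= _); last first.
    rewrite norm_joinEr // TI_cardMg //.
    have: U :&: V1 \subset V0 :&: V1 by rewrite setSI.
    by rewrite tiV01 => /trivgP.
  rewrite subset_leq_card // -(genV U sU0 ntU) gen_subG class_supportEr.
  apply/bigcupsP=> x Gx; have [Kx | nKx] := boolP (x \in K).
    by rewrite (normP (subsetP nUK x Kx)) joing_subl.
  have sV01: V0 :^ x \subset V1 by rewrite V0conj // inE nKx.
  by rewrite (subset_trans _ (joing_subr _ _)) // (subset_trans _ sV01) ?conjSg.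
have ntV0: V0 != 1 by [].
have [t Gt nKt]: exists2 t, t \in G & t \notin K.
  apply/subsetPn; rewrite -indexg_gt1 iK prime_gt1 //.
have GKt: t \in G :\: K by apply/setDP.
have prGK: prime #|G : K| by rewrite iK.
pose W m := V0 :^ (t ^+ m).
pose J m := <<\bigcup_(i < m) W i>>.
have sWV m : W m \subset V.
  by rewrite -(normP (subsetP nVG (t ^+ m) (groupX m Gt))) conjSg.
have sJV m : J m \subset V by rewrite gen_subG; apply/bigcupsP=> i _.
have JS m : J m.+1 = J m * W m.
  rewrite /J big_ord_recr /= -[LHS]/(_ <*> W m) -joing_idl norm_joinEr //.
  exact: subset_trans (sWV m) (sub_abelian_norm abV (sJV m)).
(* The conjugates before the [m]-th lie in [V1 :^ (t ^+ m)], which meets [W m] trivially. *)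
have oJ m : m <= q -> #|J m| = (#|V0| ^ m)%N.
  elim: m => [|m IHm] ltmq; first by rewrite /J big_ord0 gen0 cards1.
  rewrite JS TI_cardMg ?IHm 1?ltnW ?cardJg ?expnSr //.
  have sJ1: J m \subset V1 :^ (t ^+ m).
    rewrite gen_subG; apply/bigcupsP=> i _.
    rewrite -sub_conjgV -conjsgM.
    have ->: t ^+ i * t ^- m = (t ^+ (m - i))^-1.
      by rewrite -[X in t ^- X](subnK (ltnW (ltn_ord i))) expgD invMg mulKVg.
    apply: V0conj; rewrite inE !groupV -in_setD expg_prime_index //.
    rewrite iK subn_gt0 ltn_ord /=; exact: leq_ltn_trans (leq_subr _ _) ltmq.
  apply/trivgP; apply: subset_trans (setSI _ sJ1) _.
  by rewrite /W -conjIg setIC tiV01 conjs1g.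
have genJ: V \subset J q.
  rewrite -(genV [group of V0]) // gen_subG class_supportEr.
  apply/bigcupsP=> x Gx; have [i lti Kxi] := rcoset_prime_index nsKG prGK GKt Gx.
  have -> : V0 :^ x = W i.
    by rewrite -[x](mulgKV (t ^+ i)) conjsgM (normP (subsetP nV0K _ Kxi)).
  rewrite iK in lti; rewrite sub_gen //.
  exact: (bigcup_sup (Ordinal lti)).
have expg_lt i : i < q.-1 -> t ^+ i.+1 \in G :\: K.
  by move=> lti; rewrite expg_prime_index // iK -(ltn_predK (prime_gt0 q_pr)).
have defJ: J q = V by apply/eqP; rewrite eqEsubset sJV genJ.
exists [group of K], [group of V0], [group of V1], t; split=> //; split=> //=.
- by rewrite -defJ oJ.
- have defJ1: J q.-1.+1 = V by rewrite prednK ?prime_gt0.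
  set J1 := <<_>>.
  have sJ1V1: J1 \subset V1.
    by rewrite gen_subG; apply/bigcupsP=> i _; apply/V0conj/expg_lt/ltn_ord.
  have defV: V \subset V0 <*> J1.
    rewrite -defJ1 gen_subG; apply/bigcupsP=> -[[|i] /= lti] _.
      by rewrite /W conjsg1 joing_subl.
    rewrite (subset_trans _ (joing_subr _ _)) // sub_gen //.
    exact: (bigcup_sup (Ordinal (lti : i < q.-1))).
  rewrite (_ : V1 = J1) //; apply/esym/eqP; rewrite eqEcard sJ1V1.
  rewrite -(leq_pmul2l (cardG_gt0 [group of V0])) /= oV.
  apply: leq_trans (subset_leq_card defV) _.
  have sJ1V := subset_trans sJ1V1 sV1V.
  rewrite norm_joinEr; first by rewrite mul_cardG leq_pmulr.
  exact: subset_trans sJ1V (sub_abelian_norm abV sV0V).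
(* Semiregularity of the group [<[z]>] of order [q] gives [q < #|V0|]. *)
have regz: semiregular V0 <[z]>.
  move=> x /setD1P[ntx zx]; have Zx: x \in 'Z(G).
    by apply: subsetP zx; rewrite cycle_subG.
  apply/trivgP; apply: subset_trans (setSI _ sV0V) _.
  by rewrite (minnormal_cent_central minV cGV1 Zx ntx).
have nV0z: <[z]> \subset 'N([group of V0]).
  rewrite cycle_subG; apply: subsetP nV0K _ _.
  by rewrite defK inE Gz /= (subsetP abE).
have := regular_norm_dvd_pred nV0z regz; rewrite -orderE oz => /dvdn_leq.
have V0gt1: 1 < #|V0| by rewrite (cardG_gt1 [group of V0]).
by rewrite -[X in q < X](ltn_predK V0gt1) ltnS; apply; rewrite -subn1 subn_gt0.
Qed.

Lemma blocks_cent (gT : finGroupType) (G V K V0 V1 : {group gT}) q t :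
    blocks G V q K V0 V1 t -> 'C_G(V) = 1 ->
  'C_K(\bigcup_(U <- [seq (V0 :^ (t ^+ i))%G | i <- iota 0 q]) U) = 1.
Proof.
move=> bl cGV1; apply/trivgP.
suff: 'C_K(\bigcup_(U <- [seq (V0 :^ (t ^+ i))%G | i <- iota 0 q]) U)
        \subset 'C_G(V) by rewrite cGV1.
have [sKG _] := andP (bl_norm bl).
rewrite subsetI subIset ?sKG //= (subset_trans (subsetIr _ _)) //.
rewrite big_map -[q]subn0 big_mkord -cent_gen centS //.
exact: bl_gen bl.
Qed.

Lemma blocks_norm (gT : finGroupType) (G V K V0 V1 : {group gT}) q t i :
  blocks G V q K V0 V1 t -> K \subset 'N(V0 :^ (t ^+ i)).
Proof.
move=> bl; have /setDP[Gt _] := bl_t bl.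
have nKt := subsetP (normal_norm (bl_norm bl)) t Gt.
by rewrite normJ -(normP (groupX i nKt)) conjSg (bl_nV0 bl).
Qed.

(** Each of the [q] blocks supplies a factor [beta]. One of them is kept, and the other [q.-1]
    together absorb the index [q]. *)
Lemma layer_arith q b beta v : 0 < q -> 1 < beta -> b * beta < v ->
  q * b ^ q * beta < v ^ q.
Proof.
move=> q_gt0 beta_gt1 ltv; have: (b * beta) ^ q < v ^ q by rewrite ltn_exp2r.
apply: leq_ltn_trans; rewrite expnMn mulnAC mulnC leq_mul2l; apply/orP; right.
case: q q_gt0 => // q _; rewrite expnSr leq_mul2r; apply/orP; right.
exact: ltn_expl.
Qed.

Lemma dprod_index_join (gT : finGroupType) (G Y T A B : {group gT}) :
    Y \x T = G -> A \subset Y -> B \subset T ->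
  #|G : A <*> B| = (#|Y : A| * #|T : B|)%N.
Proof.
move=> defG sAY sBT; have [_ mulG cYT tiYT] := dprodP defG.
have defAB: A \x B = A <*> B.
  rewrite dprodEY ?(centSS sBT sAY) //.
  by apply/trivgP; rewrite -tiYT setISS.
apply/eqP; rewrite -(eqn_pmul2l (cardG_gt0 (A <*> B))) Lagrange; last first.
  by rewrite join_subG -mulG (subset_trans sAY) ?mulG_subl // (subset_trans sBT) ?mulG_subr.
by rewrite -(dprod_card defAB) mulnACA !Lagrange // (dprod_card defG).
Qed.

(** * Block decompositions when [G] is not a [q]-group *)

Section MixedBlocks.

Variables (gT : finGroupType) (G V K V0 V1 : {group gT}) (q : nat) (t : gT).
Hypotheses (nilG : nilpotent G) (abV : abelian V) (coVG : coprime #|V| #|G|).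
Hypotheses (nVG : G \subset 'N(V)) (cGV1 : 'C_G(V) = 1) (q_pr : prime q).
Hypotheses (bl : blocks G V q K V0 V1 t) (sTK : 'O_q^'(G) \subset K).
Hypothesis IH : forall Y U : {group gT}, #|U| < #|V| ->
  nilpotent Y -> Y \subset 'N(U) -> abelian U -> coprime #|U| #|Y| ->
  U :!=: 1 -> #|Y : 'L_3(Y) <*> 'C_Y(U)| < #|U|.

Let S := 'O_q(G).
Let T := 'O_q^'(G).

(** Modulo [T], which normalizes [V0], every power of [t] is an element of [S], and [S] centralizes
    [T]. So ['C_T(V0)] centralizes all blocks. *)
Lemma mixed_blocks_faithful i : 'C_T(V0 :^ (t ^+ i)) = 1.
Proof.
have [_ defG cST _] := dprodP (nilpotent_pcoreC q nilG).
have [Gt _] := setDP (bl_t bl).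
have nTG : G \subset 'N(T) by apply: gFnorm.
suff C1: 'C_T(V0) = 1.
  rewrite -{1}(normP (subsetP nTG _ (groupX i Gt))) centJ -conjIg C1.
  exact: conjs1g.
apply/trivgP; suff: 'C_T(V0) \subset 'C_G(V) by rewrite cGV1.
rewrite subsetI subIset ?pcore_sub //=.
apply: subset_trans (centS (bl_gen bl)); rewrite cent_gen centsC.
apply/bigcupsP=> j _.
have: t ^+ j \in G by rewrite groupX.
rewrite -defG => /mulsgP[s x Ss Tx ->].
rewrite -(centsP cST x Tx s Ss) conjsgM.
rewrite (normP (subsetP (bl_nV0 bl) x (subsetP sTK x Tx))).
rewrite centsC; have Cs: s \in 'C('C_T(V0)).
  by rewrite (subsetP _ s Ss) // centsC (subset_trans (subsetIl _ _)).
by rewrite -(normP (subsetP (cent_sub _) s Cs)) centJ conjSg subsetIr.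
Qed.

(** Apply the induction hypothesis to [Y \x T] on one block. As [T] is faithful there, the kernel
    lies in [Y] and the index splits as a product. *)
Lemma mixed_blocks_layer i (Y : {group gT}) :
    Y \subset S -> Y \subset K ->
  #|Y : 'L_3(Y) <*> 'C_Y(V0 :^ (t ^+ i))| * #|T : 'L_3(T)| < #|V0|.
Proof.
move=> sYS sYK; set W := (V0 :^ (t ^+ i))%G.
have [_ defG cST tiST] := dprodP (nilpotent_pcoreC q nilG).
have [Gt _] := setDP (bl_t bl).
have sTG : T \subset G := pcore_sub _ _.
have sYG : Y \subset G := subset_trans sYS (pcore_sub _ _).
have cYT: T \subset 'C(Y) := subset_trans cST (centS sYS).
have tiYT: Y :&: T = 1 by apply/trivgP; rewrite -tiST setSI.
have defYT: Y \x T = Y <*> T by rewrite dprodEY.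
have sYTG: Y <*> T \subset G by rewrite join_subG sYG.
have sWV: W \subset V.
  by rewrite -(normP (subsetP nVG _ (groupX i Gt))) conjSg (bl_sub bl).
have oW: #|W| = #|V0| by rewrite cardJg.
have W_gt1: 1 < #|W| by rewrite oW (leq_ltn_trans _ (bl_lt bl)) ?prime_gt0.
have ltWV: #|W| < #|V|.
  rewrite (bl_card bl) oW -[ltnLHS]expn1 ltn_exp2l ?(prime_gt1 q_pr) //.
  by rewrite -oW.
have nWYT: Y <*> T \subset 'N(W).
  by rewrite join_subG !(subset_trans _ (blocks_norm i bl)).
have coWYT: coprime #|W| #|Y <*> T|.
  exact: coprimeSg sWV (coprimegS sYTG coVG).
have ntW: W :!=: 1 by rewrite -cardG_gt1.
have := IH ltWV (nilpotentS sYTG nilG) nWYT (abelianS sWV abV) coWYT ntW.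
rewrite -oW; set C := 'C_(Y <*> T)(W); apply: leq_ltn_trans.
have sCY: C \subset Y.
  have nilC: nilpotent C := nilpotentS (subset_trans (subsetIl _ _) sYTG) nilG.
  have sCG: C \subset G := subset_trans (subsetIl _ _) sYTG.
  have [_ defC _ _] := dprodP (nilpotent_pcoreC q nilC).
  have C1: 'O_q^'(C) = 1.
    apply/trivgP.
    suff: 'O_q^'(C) \subset 'C_T(V0 :^ (t ^+ i)) by rewrite mixed_blocks_faithful.
    rewrite subsetI (subset_trans (pcore_sub _ _) (subsetIr _ _)) andbT.
    rewrite sub_Hall_pcore ?pcore_pgroup ?(subset_trans (pcore_sub _ _)) //.
    exact: nilpotent_pcore_Hall.
  have sCS: C \subset S.
    rewrite sub_Hall_pcore //; last exact: nilpotent_pcore_Hall.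
    by rewrite -defC C1 mulg1 pcore_pgroup.
  have: C \subset Y <*> T :&: S by rewrite subsetI subsetIl.
  by rewrite cent_joinEr // -group_modl //= setIC tiST mulg1.
have sCCY: C \subset 'C_Y(W) by rewrite subsetI sCY subsetIr.
rewrite -(dprod_index_join defYT) ?lcn_sub //; last first.
  by rewrite join_subG lcn_sub subsetIl.
rewrite dvdn_leq // indexgS // join_subG; apply/andP; split.
  rewrite -(dprodW (lcn_dprod 3 defYT)) mul_subG ?joing_subr //.
  by rewrite (subset_trans (joing_subl _ 'C_Y(W))) ?joing_subl.
apply: subset_trans sCCY _; apply: subset_trans (joing_subr 'L_3(Y) _) _.
exact: joing_subl.
Qed.

Lemma mixed_blocks_bound : T != 1 -> #|G : 'L_3(G)| < #|V|.
Proof.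
move=> ntT; have [_ mulST cST tiST] := dprodP (nilpotent_pcoreC q nilG).
set beta := #|T : 'L_3(T)|; have beta_gt1: 1 < beta.
  have nilT: nilpotent T := nilpotentS (pcore_sub _ _) nilG.
  rewrite indexg_gt1; apply/negP=> sTL.
  have := nil_comm_properl nilT (subxx _) ntT (_ : T \subset 'N_T(T)).
  rewrite subsetI subxx normG => /(_ isT); apply/negP; rewrite negb_and orbC.
  rewrite negbK (subset_trans sTL) //; exact: (lcn_sub_leq _ (_ : 2 <= 3)).
(* The largest [b] with [b * beta < #|V0|]; it bounds every layer of [S0]. *)
pose b := (#|V0|.-1 %/ beta)%N; pose S0 := (S :&: K)%G.
have sV0 : 0 < #|V0| := cardG_gt0 V0.
have lt_b: b * beta < #|V0|.
  by rewrite -(ltn_predK sV0) ltnS leq_divM.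
have leS0: #|S0 : 'L_3(S0)| <= b ^ q.
  pose s := [seq (V0 :^ (t ^+ i))%G | i <- iota 0 q].
  have := @index_layers gT (fun Y => 'L_3(Y)%G) _ _ S0 s (fun _ => b) _ _ S0 (normal_refl _).
  have -> : 'C_S0(\bigcup_(U <- s) U) = 1.
    apply/trivgP; suff: 'C_S0(\bigcup_(U <- s) U) \subset 'C_K(\bigcup_(U <- s) U).
      by rewrite (blocks_cent bl cGV1).
    by rewrite setSI ?subsetIr.
  rewrite big_const_seq count_predT size_map size_iota iter_muln_1 joingG1.
  apply=> [Y Y1|Y|U|U Y].
  - exact: lcnS.
  - exact: lcn_normal.
  - case/mapP=> i _ ->; rewrite (subset_trans (subsetIr _ _)) //.
    exact: blocks_norm bl.
  case/mapP=> i _ -> nsYS0; rewrite leq_divRL ?(ltnW beta_gt1) //.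
  rewrite -ltnS (ltn_predK sV0); have sYS0 := normal_sub nsYS0.
  by apply: mixed_blocks_layer; rewrite (subset_trans sYS0) ?subsetIl ?subsetIr.
have oS : #|S : S0| = q.
  have [sKG _] := andP (bl_norm bl).
  rewrite indexgI -[RHS](bl_index bl) -indexMg; congr #|_ : _|.
  apply/eqP; rewrite eqEsubset mul_subG ?pcore_sub //=.
  suff: S * T \subset K * S by rewrite mulST.
  have nKS: S \subset 'N(K).
    exact: subset_trans (pcore_sub _ _) (normal_norm (bl_norm bl)).
  rewrite -(norm_joinEr nKS) mul_subG ?joing_subr //.
  exact: subset_trans sTK (joing_subl _ _).
rewrite (dprod_index_lcn 3 (nilpotent_pcoreC q nilG)) -/T -/beta (bl_card bl).
apply: leq_ltn_trans (layer_arith (prime_gt0 q_pr) beta_gt1 lt_b).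
rewrite leq_mul2r; apply/orP; right.
apply: (@leq_trans #|S : 'L_3(S0)|).
  by rewrite dvdn_leq // indexgS // lcnS ?subsetIl.
by rewrite -(Lagrange_index (subsetIl S K) (lcn_sub 3 S0)) oS leq_mul2l leS0 orbT.
Qed.

End MixedBlocks.

(** * Orders of [q]-groups for odd [q] *)

Lemma order_layer_arith q b k v : 1 < q -> k <= b ^ q -> b * q <= v ^ 2 ->
  q * (q * k) <= (v ^ q) ^ 2.
Proof.
move=> q_gt1 lek leb; have q_gt0 := ltnW q_gt1.
(* Each of the [q] blocks spares a factor [q], and [q ^ 2 <= q ^ q]. *)
rewrite -expnM [(q * 2)%N]mulnC expnM; apply: (@leq_trans ((b * q) ^ q)).
  rewrite expnMn mulnA [leqRHS]mulnC leq_mul // -[(q * q)%N]/(q ^ 2)%N.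
  by rewrite leq_exp2l.
by rewrite leq_exp2r.
Qed.

(** The alternatives equal to 1 stand for trivial actions, for which the bound with the extra factor
    [q] can fail. *)
Lemma reducible_order_arith (q g c v1 v2 v : nat) : 1 < q ->
    0 < v1 -> 0 < v2 -> g = 1%N \/ q * g <= v1 ^ 2 -> c = 1%N \/ q * c <= v2 ^ 2 ->
    v1 * v2 <= v -> 1 < c * g ->
  q * (c * g) <= v ^ 2.
Proof.
move=> q_gt1 v1_gt0 v2_gt0 IH1 IH2 lev cg_gt1.
have lev2: v1 ^ 2 * v2 ^ 2 <= v ^ 2 by rewrite -expnMn leq_exp2r.
apply: leq_trans lev2; case: IH1 cg_gt1 => [->|IH1] cg_gt1.
  case: IH2 cg_gt1 => [->|IH2] // _; rewrite muln1.
  by apply: leq_trans IH2 _; rewrite leq_pmull ?expn_gt0 ?v1_gt0.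
case: IH2 cg_gt1 => [->|IH2] _.
  by rewrite mul1n; apply: leq_trans IH1 _; rewrite leq_pmulr ?expn_gt0 ?v2_gt0.
apply: leq_trans (leq_mul IH1 IH2); rewrite mulnACA [(c * g)%N]mulnC leq_mul2r.
by rewrite leq_pmull ?orbT // ltnW.
Qed.

Lemma not_minnormal_sub (gT : finGroupType) (G V : {group gT}) :
    G \subset 'N(V) -> V :!=: 1 -> ~~ minnormal V G ->
  exists V1 : {group gT}, [/\ V1 \proper V, V1 :!=: 1 & G \subset 'N(V1)].
Proof.
move=> nVG ntV nminV; have [|V1 minV1 sV1V] := @mingroup_exists _
  (fun U : {group gT} => (U :!=: 1) && (G \subset 'N(U))) V.
  by rewrite ntV.
exists V1; have /andP[ntV1 nV1G] := mingroupp minV1; split=> //.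
rewrite properEneq sV1V andbT; apply: contraNneq nminV => defV.
by rewrite -(group_inj defV).
Qed.

(** The induction follows that of the class 2 bound but counts whole orders. For odd [q] the rank
    one case leaves only cyclic groups, which act semiregularly, so [q <= #|G| < #|V|]. *)
Lemma odd_pgroup_order_bound (q : nat) : prime q -> odd q ->
  forall (gT : finGroupType) (G V : {group gT}),
    q.-group G -> G \subset 'N(V) -> abelian V -> coprime #|V| #|G| ->
    ~~ (G \subset 'C(V)) ->
  q * #|G : 'C_G(V)| <= #|V| ^ 2.
Proof.
move=> q_pr q_odd gT G V; have [n] := ubnP #|V|.
elim: n gT G V => // n IHn gT G V ltVn.
wlog cGV1: gT G V ltVn / 'C_G(V) = 1 => [IHf|].
  move=> qG nVG abV coVG ncGV.
  have tiGV: G :&: V = 1 by rewrite setIC coprime_TIg.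
  have nsCG: 'C_G(V) <| G by rewrite /normal subsetIl normsI ?normG ?norms_cent.
  rewrite -(card_quotient (normal_norm nsCG)) -(card_quotient_cent tiGV).
  have C1 := cent_quotient_cent nVG tiGV.
  have := IHf _ (G / 'C_G(V))%G (V / 'C_G(V))%G.
  rewrite /= C1 (card_quotient_cent tiGV) indexg1; apply=> //.
  - exact: quotient_pgroup.
  - exact: norm_quotient_cent.
  - exact: quotient_abelian.
  - exact: coprime_dvdr (dvdn_quotient _ _) coVG.
  apply: contra ncGV => cGV; have: G / 'C_G(V) \subset 'C_(G / 'C_G(V))(V / 'C_G(V)).
    by rewrite subsetI subxx.
  rewrite C1 quotient_sub1 ?(normal_norm nsCG) // => /subset_trans->//.
  exact: subsetIr.
move=> qG nVG abV coVG ncGV; rewrite cGV1 indexg1.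
have ntG: G :!=: 1 by apply: contraNneq ncGV => ->; apply: sub1G.
have ntV: V :!=: 1 by apply: contraNneq ncGV => ->; rewrite centsC sub1G.
have IHl (Y U : {group gT}) : Y \subset G -> Y \subset 'N(U) -> U \proper V ->
   #|Y : 'C_Y(U)| = 1%N \/ q * #|Y : 'C_Y(U)| <= #|U| ^ 2.
  move=> sYG nUY ltUV; have [cYU | ncYU] := boolP (Y \subset 'C(U)).
    by left; rewrite (setIidPl cYU) indexgg.
  right; apply: IHn => //.
  - exact: leq_trans (proper_card ltUV) _.
  - exact: pgroupS qG.
  - exact: abelianS (proper_sub ltUV) abV.
  exact: coprimeSg (proper_sub ltUV) (coprimegS sYG coVG).
have [minV | nminV] := boolP (minnormal V G); last first.
  have [V1 [ltV1 ntV1 nV1G]] := not_minnormal_sub nVG ntV nminV.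
  (* The layers are [G / C1] on [V1] and [C1] on [V2], where [C1] is faithful; since [V1] lies in
     ['C_V(C1)], [#|V1| * #|V2| <= #|V|]. *)
  set C1 := 'C_G(V1)%G; pose V2 := [~: V, C1]%G.
  have sC1G : C1 \subset G := subsetIl _ _.
  have nVC1 : C1 \subset 'N(V) := subset_trans sC1G nVG.
  have coVC1 : coprime #|V| #|C1| := coprimegS sC1G coVG.
  have oV := coprime_abel_card nVC1 coVC1 abV.
  have sV1C : V1 \subset 'C_V(C1).
    by rewrite subsetI (proper_sub ltV1) centsC subsetIr.
  have leV1C := subset_leq_card sV1C.
  have V1gt1 : 1 < #|V1| by rewrite cardG_gt1.
  have ltV2 : V2 \proper V.
    rewrite properEcard commg_subl nVC1 -oV.
    by rewrite ltn_Pmulr // (leq_trans V1gt1).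
  have cV2 : 'C_C1(V2) = 1.
    rewrite coprime_comm_faithful //; apply/trivgP.
    suff: 'C_C1(V) \subset 'C_G(V) by rewrite cGV1.
    by rewrite setSI.
  have IH1 := IHl _ _ (subxx G) nV1G ltV1.
  have IH2 := IHl _ V2 sC1G (commg_normr _ _) ltV2.
  have leV : #|V1| * #|V2| <= #|V| by rewrite -oV mulnC leq_mul.
  have G_gt1 : 1 < #|C1| * #|G : C1| by rewrite Lagrange ?cardG_gt1.
  rewrite cV2 indexg1 in IH2; rewrite -(Lagrange sC1G).
  exact: reducible_order_arith (prime_gt1 q_pr) _ _ IH1 IH2 leV G_gt1.
have [rank1G | nrank1] := boolP [forall X : {group gT}, (X <| 'O_q(G)) && abelian X ==> cyclic X].
  have abG: abelian G.
    have [X nsX abX||/and3P[/eqP q2]] := normal_rank1_structure qG; last by rewrite q2 in q_odd.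
      move/forallP/(_ X): rank1G; rewrite pcore_pgroup_id //.
      by move/implyP; apply; apply/andP.
    exact: cyclic_abelian.
  have ltG: #|G| < #|V|.
    apply: (semiregular_card_lt minV); apply: semiregular_central_prime => // x.
    by rewrite (center_idP abG).
  have [_ q_dv _] := pgroup_pdiv qG ntG.
  rewrite -mulnn leq_mul // ltnW //; apply: leq_ltn_trans ltG.
  exact: dvdn_leq.
have [X /andP[/andP[nsX abX] ncX]] : exists X : {group gT}, ((X <| 'O_q(G)) && abelian X) && ~~ cyclic X.
  by move: nrank1; rewrite negb_forall => /existsP[X]; rewrite negb_imply; exists X.
have nilG := pgroup_nil qG.
have [_ [K [V0 [W [t [bl _]]]]]] := blocks_exist nilG abV coVG minV cGV1 nsX abX ncX.
have [sKG nKG] := andP (bl_norm bl); have [Gt _] := setDP (bl_t bl).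
(* This bounds every layer: a nontrivial one by induction, a trivial one because [q < #|V0|]. *)
pose b := (#|V0| ^ 2 %/ q)%N.
have leK: #|K| <= b ^ q.
  pose s := [seq (V0 :^ (t ^+ i))%G | i <- iota 0 q].
  have := @index_layers gT (fun Y => 1%G) _ _ K s (fun _ => b) _ _ K (normal_refl _).
  rewrite (blocks_cent bl cGV1) joingG1 indexg1.
  rewrite big_const_seq count_predT size_map size_iota iter_muln_1.
  apply=> [Y Y1|Y|U|U Y] //.
  - exact: normal1.
  - by case/mapP=> i _ ->; apply: blocks_norm bl.
  case/mapP=> i _ -> nsYK; rewrite joing1G leq_divRL ?prime_gt0 //.
  have sYK := normal_sub nsYK; rewrite mulnC -(cardJg V0 (t ^+ i)).
  have oVi : #|V0 :^ (t ^+ i)| = #|V0| by rewrite cardJg.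
  have ltVi : (V0 :^ (t ^+ i))%G \proper V.
    rewrite properEcard oVi -{1}(normP (subsetP nVG _ (groupX i Gt))) conjSg (bl_sub bl).
    rewrite (bl_card bl) -[ltnLHS]expn1 ltn_exp2l ?(prime_gt1 q_pr) //.
    by rewrite (leq_ltn_trans _ (bl_lt bl)) ?prime_gt0.
  have [| |-> | //] := IHl Y (V0 :^ (t ^+ i))%G _ _ ltVi.
  - exact: subset_trans sYK sKG.
  - exact: subset_trans sYK (blocks_norm i bl).
  rewrite muln1 /= oVi -mulnn; apply: leq_trans (ltnW (bl_lt bl)) _.
  by rewrite leq_pmulr.
rewrite -(Lagrange sKG) (bl_index bl) (bl_card bl) [(#|K| * q)%N]mulnC.
apply: order_layer_arith (prime_gt1 q_pr) leK _; exact: leq_divM.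
Qed.

(** * Block decompositions for groups of prime power order *)

Section PrimePowerBlocks.

Variables (gT : finGroupType) (G V K V0 V1 : {group gT}) (q : nat) (t : gT).
Hypotheses (qG : q.-group G) (abV : abelian V) (coVG : coprime #|V| #|G|).
Hypotheses (nVG : G \subset 'N(V)) (cGV1 : 'C_G(V) = 1) (q_pr : prime q).
Hypothesis bl : blocks G V q K V0 V1 t.
Hypothesis IH : forall Y U : {group gT}, #|U| < #|V| ->
  nilpotent Y -> Y \subset 'N(U) -> abelian U -> coprime #|U| #|Y| ->
  U :!=: 1 -> #|Y : 'L_3(Y) <*> 'C_Y(U)| < #|U|.

(* [q ^ a] is the largest power of [q] below [#|V0|]. *)
Let a := trunc_log q #|V0|.-1.
Let D := 'L_3(K)%G.
Let H := 'C_K(V1)%G.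
Let C0 := 'C_K(V0)%G.

Let q_gt1 := prime_gt1 q_pr.
Let sKG := normal_sub (bl_norm bl).
Let nKG := normal_norm (bl_norm bl).
Let Gt : t \in G. Proof. by case/setDP: (bl_t bl). Qed.

Lemma blocks_V0_gt1 : 1 < #|V0|.
Proof. exact: leq_ltn_trans (prime_gt0 q_pr) (bl_lt bl). Qed.

Lemma blocks_log_bounds : q ^ a < #|V0| <= q ^ a.+1.
Proof.
have V0gt1 := blocks_V0_gt1; have V0_gt0 := ltnW V0gt1.
have: q ^ a <= #|V0|.-1 < q ^ a.+1.
  by apply: trunc_log_bounds => //; rewrite -ltnS prednK.
by rewrite -ltnS prednK //; case: (#|V0|) V0_gt0.
Qed.

Lemma blocks_lt_card i : #|V0 :^ (t ^+ i)| < #|V|.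
Proof.
rewrite cardJg (bl_card bl) -[ltnLHS]expn1 ltn_exp2l ?blocks_V0_gt1 //.
Qed.

Lemma blocks_conj_sub i : V0 :^ (t ^+ i) \subset V.
Proof.
by rewrite -(normP (subsetP nVG _ (groupX i Gt))) conjSg (bl_sub bl).
Qed.

(** By induction the index is a power of [q] below [#|V0|], hence below [q ^ a.+1]. *)
Lemma blocks_layer i (Y : {group gT}) : Y \subset K ->
  #|Y : 'L_3(Y) <*> 'C_Y(V0 :^ (t ^+ i))| <= q ^ a.
Proof.
move=> sYK; have qY: q.-group Y := pgroupS (subset_trans sYK sKG) qG.
have [m om]: {m | #|Y : 'L_3(Y) <*> 'C_Y(V0 :^ (t ^+ i))| = (q ^ m)%N}.
  by apply: p_natP; apply: pnat_dvd (dvdn_indexg _ _) qY.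
have [_ leVa] := andP blocks_log_bounds.
rewrite om leq_exp2l // -ltnS -(ltn_exp2l _ _ q_gt1) -om.
apply: leq_trans leVa; rewrite -[X in _ < X](cardJg V0 (t ^+ i)).
apply: IH; first exact: blocks_lt_card.
- exact: pgroup_nil qY.
- exact: subset_trans sYK (blocks_norm i bl).
- exact: abelianS (blocks_conj_sub i) abV.
- exact: coprimeSg (blocks_conj_sub i) (coprimegS (subset_trans sYK sKG) coVG).
by rewrite -cardG_gt1 /= cardJg blocks_V0_gt1.
Qed.

(** The range starting at [m = 1] leaves out [V0] and is used to separate [H] and [C0]. *)
Lemma blocks_layers m n (Y : {group gT}) : Y <| K ->
  #|Y : 'L_3(Y) <*> 'C_Y(\bigcup_(m <= i < n) V0 :^ (t ^+ i))|
    <= q ^ (a * (n - m)).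
Proof.
move=> nsYK; pose s := [seq (V0 :^ (t ^+ i))%G | i <- index_iota m n].
have := @index_layers gT (fun Y => 'L_3(Y)%G) _ _ K s (fun _ => q ^ a)%N _ _ Y nsYK.
rewrite big_const_seq count_predT size_map size_iota iter_muln_1 -expnM big_map.
apply=> [Z Z1|Z|U|U Z].
- exact: lcnS.
- exact: lcn_normal.
- by case/mapP=> i _ ->; apply: blocks_norm bl.
by case/mapP=> i _ -> nsZK; apply/blocks_layer/normal_sub.
Qed.

Lemma blocks_cent_gen (Y : {group gT}) : Y \subset K ->
  'C_Y(\bigcup_(0 <= i < q) V0 :^ (t ^+ i)) = 1.
Proof.
move=> sYK; apply/trivgP; suff: 'C_Y(\bigcup_(0 <= i < q) V0 :^ (t ^+ i)) \subset 'C_G(V) by rewrite cGV1.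
rewrite big_mkord; apply: setISS; first exact: subset_trans sYK sKG.
by rewrite -cent_gen centS // (bl_gen bl).
Qed.

Lemma blocks_cent_gen1 (Y : {group gT}) :
  'C_Y(\bigcup_(1 <= i < q) V0 :^ (t ^+ i)) \subset 'C_Y(V1).
Proof.
rewrite -[q]prednK ?prime_gt0 // big_add1 big_mkord /= setIS // -cent_gen centS //.
exact: bl_gen1 bl.
Qed.

Lemma blocks_tiHC0 : H :&: C0 = 1.
Proof.
apply/trivgP; suff: H :&: C0 \subset 'C_G(V) by rewrite cGV1.
apply/subsetP=> x /setIP[/setIP[Kx cV1x] /setIP[_ cV0x]].
by rewrite -(bl_mul bl) centM inE (subsetP sKG) // inE cV0x.
Qed.

Lemma blocks_conjH x : x \in G :\: K -> H :^ x \subset C0.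
Proof.
case/setDP=> Gx nKx; rewrite conjIg (normP (subsetP nKG x Gx)) setIS //.
rewrite -centJ centS // -sub_conjgV; apply: (bl_conj bl).
by apply/setDP; rewrite !groupV.
Qed.

Lemma lcn3_sub_blocks : 'L_3(G) \subset K.
Proof.
apply: subset_trans (lcn_sub_leq G (_ : 2 <= 3)) _ => //.
apply: der1_min => //; apply/cyclic_abelian/prime_cyclic.
by rewrite card_quotient // (bl_index bl).
Qed.

Section Full.

(* In a counterexample all the layer bounds [q ^ a] are attained. *)
Hypothesis fullG : #|V| <= #|G : 'L_3(G)|.

(** The index in [G] is a power of [q] above [q ^ (a * q)]; dividing by [#|G : K| = q] leaves at
    least [q ^ (a * q)] for [K], which is the upper bound from the layers. *)
Lemma full_blocks_lcn : 'L_3(G) = D /\ #|K : D| = (q ^ (a * q))%N.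
Proof.
have leKD: #|K : D| <= q ^ (a * q).
  have := blocks_layers 0 q (normal_refl K).
  by rewrite blocks_cent_gen // joingG1 subn0.
have sDL: D \subset 'L_3(G) by apply: lcnS.
have [m om]: {m | #|G : 'L_3(G)| = (q ^ m)%N}.
  by apply: p_natP; apply: pnat_dvd (dvdn_indexg _ _) qG.
have [lt_a _] := andP blocks_log_bounds.
have oG: #|G : 'L_3(G)| = (q * #|K : 'L_3(G)|)%N.
  by rewrite -(bl_index bl) Lagrange_index ?lcn3_sub_blocks.
have geKL: q ^ (a * q) <= #|K : 'L_3(G)|.
  rewrite -(leq_pmul2l (prime_gt0 q_pr)) -oG om -expnS leq_exp2l //.
  rewrite -(ltn_exp2l _ _ q_gt1) -om expnM; apply: leq_trans fullG.
  by rewrite (bl_card bl) ltn_exp2r ?prime_gt0.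
have oKL := Lagrange_index lcn3_sub_blocks sDL.
have eqKD: #|K : D| = (q ^ (a * q))%N.
  apply/eqP; rewrite eqn_leq leKD (leq_trans geKL) // -oKL.
  by rewrite leq_pmulr.
split=> //; apply/eqP; rewrite eqEsubset sDL andbT -indexg_eq1.
rewrite eqn_leq indexg_gt0 andbT -(leq_pmul2l (indexg_gt0 K 'L_3(G))) oKL muln1.
by rewrite eqKD.
Qed.

Lemma full_blocks_card : #|V0| ^ q <= q ^ (a * q).+1.
Proof.
have [eqL oKD] := full_blocks_lcn.
rewrite -(bl_card bl) (leq_trans fullG) // eqL expnS -oKD -(bl_index bl).
by rewrite Lagrange_index ?lcn_sub.
Qed.

(** In [#|K : D| = #|K : D <*> H| * #|H : H :&: D|] the first factor uses the [q.-1] blocks in [V1]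
    and the second only [V0], so both layer bounds are attained. *)
Lemma full_blocks_H : H :&: D = 'L_3(H) /\ #|H : 'L_3(H)| = (q ^ a)%N.
Proof.
have [eqL oKD] := full_blocks_lcn.
have nsHK: H <| K.
  by rewrite /normal subsetIl normsI ?normG ?norms_cent ?(bl_nV1 bl).
have leH: #|H : 'L_3(H)| <= q ^ a.
  have := blocks_layer 0 (normal_sub nsHK); rewrite expg0 conjsg1.
  have -> : 'C_H(V0) = 1; last by rewrite joingG1.
  apply/trivgP; rewrite -[[1]]blocks_tiHC0 subsetI subsetIl setSI //.
  exact: normal_sub.
have leKH: #|K : D <*> H| <= q ^ (a * q.-1).
  have := blocks_layers 1 q (normal_refl K); rewrite subn1; apply: leq_trans.
  rewrite dvdn_leq // indexgS // genS // setUS //; exact: blocks_cent_gen1.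
have sLHD: 'L_3(H) \subset H :&: D by rewrite subsetI lcn_sub lcnS ?subsetIl.
have oK: (#|K : D <*> H| * #|H : H :&: D|)%N = #|K : D|.
  rewrite indexgI -indexMg -norm_joinEr.
    by rewrite Lagrange_index ?joing_subl ?join_subG ?lcn_sub ?subsetIl.
  by rewrite (subset_trans (subsetIl _ _)) ?lcn_norm.
have geH: q ^ a <= #|H : H :&: D|.
  rewrite -(leq_pmul2l (_ : 0 < q ^ (a * q.-1))) ?expn_gt0 ?prime_gt0 //.
  rewrite -expnD addnC -mulnS prednK ?prime_gt0 // -oKD -oK.
  by rewrite leq_mul2r leKH orbT.
have oHL := Lagrange_index (subsetIl H D) sLHD.
have eqH: #|H : 'L_3(H)| = (q ^ a)%N.
  by apply/eqP; rewrite eqn_leq leH (leq_trans geH) // -oHL leq_pmulr.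
split=> //; apply/eqP; rewrite eqEsubset sLHD andbT -indexg_eq1.
rewrite eqn_leq indexg_gt0 andbT -(leq_pmul2l (indexg_gt0 H (H :&: D))) oHL.
by rewrite muln1 eqH.
Qed.

Lemma full_blocks_C0 : #|K : D <*> C0| = (q ^ a)%N.
Proof.
have [eqL oKD] := full_blocks_lcn.
have nsCK: C0 <| K.
  by rewrite /normal subsetIl normsI ?normG ?norms_cent ?(bl_nV0 bl).
have leK: #|K : D <*> C0| <= q ^ a.
  by have := blocks_layer 0 (subxx K); rewrite expg0 conjsg1.
have leC: #|C0 : C0 :&: D| <= q ^ (a * q.-1).
  have := blocks_layers 1 q nsCK; rewrite subn1; apply: leq_trans.
  have -> : 'C_C0(\bigcup_(1 <= i < q) V0 :^ (t ^+ i)) = 1.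
    apply/trivgP; rewrite -[[1]]blocks_tiHC0 subsetI subsetIl andbT.
    apply: subset_trans (blocks_cent_gen1 C0) _.
    by rewrite setSI ?subsetIl.
  rewrite joingG1 dvdn_leq // indexgS // subsetI lcn_sub lcnS ?subsetIl //.
have oK: (#|K : D <*> C0| * #|C0 : C0 :&: D|)%N = #|K : D|.
  rewrite indexgI -indexMg -norm_joinEr.
    by rewrite Lagrange_index ?joing_subl ?join_subG ?lcn_sub ?subsetIl.
  by rewrite (subset_trans (subsetIl _ _)) ?lcn_norm.
apply/eqP; rewrite eqn_leq leK.
rewrite -(leq_pmul2r (_ : 0 < q ^ (a * q.-1))) ?expn_gt0 ?prime_gt0 //.
rewrite -expnD -mulnS prednK ?prime_gt0 // -oKD -oK.
by rewrite leq_mul2l leC orbT.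
Qed.

End Full.

End PrimePowerBlocks.

(** Comparing exponents of [q] gives [(2 * a + 1) * q <= 2 * (a * q + 1)], that is, [q <= 2]. *)
Lemma odd_blocks_arith (q a k v : nat) : 2 < q -> 0 < v -> v ^ q <= q ^ (a * q).+1 ->
  q ^ a * q ^ a <= k -> q * k <= v ^ 2 -> False.
Proof.
move=> q_gt2 v_gt0 lev lek leq_k; have q_gt1: 1 < q := ltnW q_gt2.
have lev2: q ^ (a + a).+1 <= v ^ 2.
  by apply: leq_trans leq_k; rewrite expnS expnD leq_mul2l lek orbT.
have: q ^ ((a + a).+1 * q) <= q ^ ((a * q).+1 * 2).
  rewrite !expnM; apply: (@leq_trans ((v ^ 2) ^ q)).
    by rewrite leq_exp2r // ltnW.
  by rewrite -expnM mulnC expnM leq_exp2r.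
by rewrite leq_exp2l //; nia.
Qed.

(** In a counterexample [H] lies in ['L_3(K) <*> C0] and meets [C0] trivially, so [K / C0] has order
    at least the square of [q ^ a], too large for an odd [q]-group acting on [V0]. *)
Lemma odd_blocks_bound (gT : finGroupType) (G V K V0 V1 : {group gT}) (q : nat)
    (t : gT) :
    q.-group G -> abelian V -> coprime #|V| #|G| -> G \subset 'N(V) ->
    'C_G(V) = 1 -> prime q -> odd q -> blocks G V q K V0 V1 t ->
    (forall Y U : {group gT}, #|U| < #|V| ->
      nilpotent Y -> Y \subset 'N(U) -> abelian U -> coprime #|U| #|Y| ->
      U :!=: 1 -> #|Y : 'L_3(Y) <*> 'C_Y(U)| < #|U|) ->
  #|G : 'L_3(G)| < #|V|.
Proof.
move=> qG abV coVG nVG cGV1 q_pr q_odd bl IH; rewrite ltnNge; apply/negP=> full.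
have [eqL _] := full_blocks_lcn qG abV coVG nVG cGV1 q_pr bl IH full.
have leV0 := full_blocks_card qG abV coVG nVG cGV1 q_pr bl IH full.
have [_ oH] := full_blocks_H qG abV coVG nVG cGV1 q_pr bl IH full.
have oC0 := full_blocks_C0 qG abV coVG nVG cGV1 q_pr bl IH full.
have tiHC := blocks_tiHC0 cGV1 bl.
have conjH := blocks_conjH bl.
have V0gt1 := blocks_V0_gt1 q_pr bl.
have q_gt2 : 2 < q by apply: odd_prime_gt2.
move: leV0 oH oC0; set a := trunc_log q _; set H := 'C_K(V1)%G; set C0 := 'C_K(V0)%G.
rewrite -/H -/C0 in tiHC conjH; move=> leV0 oH oC0.
have [sKG nKG] := andP (bl_norm bl).
have nsC0K: C0 <| K.
  by rewrite /normal subsetIl normsI ?normG ?norms_cent ?(bl_nV0 bl).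
have sHK: H \subset K := subsetIl _ _.
have tK := bl_t bl; have [Gt nKt] := setDP tK.
have t2K: t ^+ 2 \in G :\: K.
  by apply: expg_prime_index (bl_norm bl) _ tK _ _; rewrite (bl_index bl).
have sHD: H \subset 'L_3(K) <*> C0.
  apply/subsetP=> h Hh; have Gh := subsetP (subset_trans sHK sKG) h Hh.
  have Dx: [~ h, t, t] \in 'L_3(K) by rewrite -eqL !lcnSn !mem_commg.
  have Cht: h ^ t \in C0 by rewrite (subsetP (conjH t tK)) ?memJ_conjg.
  have Chtt: h ^ (t ^+ 2) \in C0 by rewrite (subsetP (conjH _ t2K)) ?memJ_conjg.
  (* [[~ h, t, t]] lies in ['L_3(G) = 'L_3(K)] and the conjugates of [h] in [C0]. *)
  have -> : h = h ^ t * [~ h, t, t] * (h ^ (t ^+ 2))^-1 * h ^ t.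
    rewrite -[t ^+ 2]/(t * t) commgEl commgEl conjgM conjMg conjVg.
    move: (h ^ t) => u; move: (u ^ t) => w; rewrite invMg invgK !mulgA mulgV mul1g.
    by rewrite mulgK mulgKV.
  have sD := subsetP (joing_subl 'L_3(K) C0); have sC := subsetP (joing_subr 'L_3(K) C0).
  have Jt := sC _ Cht; have Jtt := sC _ Chtt; have Jx := sD _ Dx.
  exact: groupM (groupM (groupM Jt Jx) (groupVr Jtt)) Jt.
have geK: q ^ a * q ^ a <= #|K : C0|.
  have sC0: C0 \subset 'L_3(K) <*> C0 := joing_subr _ _.
  have sDC: 'L_3(K) <*> C0 \subset K by rewrite join_subG lcn_sub subsetIl.
  rewrite -(Lagrange_index sDC sC0) oC0 leq_mul2l; apply/orP; right.
  have sHC: H <*> C0 \subset 'L_3(K) <*> C0 by rewrite join_subG sHD joing_subr.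
  apply: leq_trans (dvdn_leq (indexg_gt0 _ _) (indexSg (joing_subr H C0) sHC)).
  rewrite /= joingC norm_joinEr; last exact: subset_trans sHK (normal_norm nsC0K).
  rewrite indexMg -indexgI tiHC indexg1 -oH -(Lagrange (lcn_sub 3 H)).
  exact: leq_pmull.
apply: (odd_blocks_arith q_gt2 (ltnW V0gt1) leV0 geK).
have sV0V := bl_sub bl.
apply: odd_pgroup_order_bound => //.
- exact: pgroupS sKG qG.
- exact: bl_nV0 bl.
- exact: abelianS abV.
- exact: coprimeSg sV0V (coprimegS sKG coVG).
(* A trivial action would force [a = 0], hence [#|V0| ^ q <= q], against [q < #|V0|]. *)
apply/negP=> cKV0; have K1: #|K : C0| = 1%N.
  by rewrite /C0 /= (setIidPl cKV0) indexgg.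
have: q ^ (a * q).+1 < #|V0| ^ q.
  have a0: a = 0%N.
    apply/eqP; rewrite -leqn0 -(leq_exp2l _ _ (ltnW q_gt2)) expn0 -K1.
    by apply: leq_trans geK; rewrite leq_pmulr ?expn_gt0 ?prime_gt0.
  rewrite a0 mul0n expn1; apply: leq_trans (bl_lt bl) _.
  rewrite -[leqLHS]expn1; apply: leq_pexp2l; [exact: ltnW | exact: prime_gt0].
by rewrite ltnNge leV0.
Qed.

(** * Block decompositions for 2-groups *)

Section ThreeSubgroups.

Variable gT : finGroupType.
Implicit Types A B C H K N X : {group gT}.

Lemma three_subgroup_mod A B C N :
    A \subset 'N(N) -> B \subset 'N(N) -> C \subset 'N(N) ->
    [~: A, B, C] \subset N -> [~: B, C, A] \subset N -> [~: C, A, B] \subset N.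
Proof.
move=> nNA nNB nNC sABC sBCA.
have quo (X Y Z : {group gT}) : X \subset 'N(N) -> Y \subset 'N(N) -> Z \subset 'N(N) ->
    [~: X / N, Y / N, Z / N] = [~: X, Y, Z] / N.
  by move=> nX nY nZ; rewrite -!quotientR // comm_subG.
rewrite -quotient_sub1 ?comm_subG // -quo //.
by rewrite three_subgroup ?quo // quotientS1.
Qed.

Lemma comm_der1_sub X K : X \subset K -> [~: K^`(1), X] \subset [~: X, K, K].
Proof.
move=> sXK; have nNK : K \subset 'N([~: X, K, K]) := commg_normr _ _.
apply: (@three_subgroup_mod K X K [~: X, K, K]%G) => //=.
  exact: subset_trans nNK.
by rewrite [[~: K, X]]commGC.
Qed.

(** The three subgroup lemma is used modulo [[~: H, K, K, K]]. The result serves to trivialize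
    ['L_3(H)] in the case [q = 2]. *)
Lemma comm_lcn3_sub H K :
  H <| K -> [~: 'L_3(K), H] \subset [~: H, K, K, K].
Proof.
case/andP=> sHK nHK; have sHKK : [~: H, K] \subset K by rewrite comm_subG.
have nNK : K \subset 'N([~: H, K, K, K]) := commg_normr _ _.
apply: (@three_subgroup_mod K H K^`(1)%G [~: H, K, K, K]%G) => //=.
- exact: subset_trans nNK.
- exact: subset_trans (der_sub 1 K) nNK.
- rewrite commGC [[~: K, H]]commGC.
  exact: (@comm_der1_sub [~: H, K]%G K sHKK).
by rewrite commSg // commGC; apply: comm_der1_sub.
Qed.

End ThreeSubgroups.

(** The inequalities give [u ^ 4 <= 32 * u.-1 ^ 2], so [u = 3]; then [v] is an odd multiple of 3
    with [9 <= v] and [v ^ 2 <= 128]. *)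
Lemma nine_arith (u v A : nat) : odd u -> 1 < u -> u %| v -> odd v -> 
  u * u <= v -> A <= 4 * u.-1 -> v * v <= 2 * (A * A) -> v = 9.
Proof.
move=> u_odd u_gt1 /dvdnP[k ->]; rewrite oddM => /andP[k_odd _] leu leA lek.
have u3: u = 3.
  apply/eqP; rewrite eqn_leq; apply/andP; split; last by case: u u_odd u_gt1 {leu leA lek} => [|[|[|]]].
  rewrite leqNgt; apply/negP=> u_gt3; have u_gt4: 4 < u by case: u u_odd u_gt3 {u_gt1 leu leA lek} => [|[|[|[|[|]]]]].
  have le6: 6 * u.-1 <= u * u by nia.
  have := leq_mul leu leu; have := leq_mul leA leA; nia.
subst u; have: k * 3 * (k * 3) <= 2 * (8 * 8).
  by apply: leq_trans lek _; rewrite leq_mul2l /=; apply: leq_mul.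
have k_gt2 : 2 < k by rewrite -(leq_pmul2r (isT : 0 < 3)).
move=> le128; have : k < 4 by nia.
by move: k_gt2; case: k {k_odd leu lek le128} => [|[|[|[|]]]].
Qed.

Lemma pred_dvd_arith (v A : nat) : 1 < v -> A %| v.-1 -> v * v <= 2 * (A * A) ->
  v = A.+1.
Proof.
case: v => [|v] // v_gt0 /dvdnP[k /= def_v]; subst v => le2.
have k_gt0: 0 < k by case: k v_gt0 {le2}.
have [k_gt1 | ] := ltnP 1 k; first by nia.
by case: k k_gt0 {v_gt0 le2} => [|[|]] // _ _; rewrite mul1n.
Qed.

Lemma odd_sum_expn (p f : nat) : odd p -> odd (\sum_(i < f) p ^ i) = odd f.
Proof.
move=> p_odd; elim: f => [|f IHf]; first by rewrite big_ord0.
by rewrite big_ord_recr oddD IHf oddX p_odd orbT addbT.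
Qed.

(** For odd [f] the sum of the [p ^ i] is an odd divisor of [2 ^ a], so [f = 1]. For even [f], with
    [x] the square root of [p ^ f], both [x.-1] and [x.+1] are powers of 2, so [x = 3]. *)
Lemma expn_pred_pow2 (p f a : nat) : prime p -> odd p -> (p ^ f)%N = (2 ^ a).+1 ->
  prime (p ^ f) \/ (p ^ f)%N = 9.
Proof.
move=> p_pr p_odd def_v; have p_gt1 := prime_gt1 p_pr.
have def_pred: (p ^ f).-1 = (2 ^ a)%N by rewrite def_v.
have pow2 m : m %| 2 ^ a -> exists i, m = (2 ^ i)%N.
  by case/dvdn_pfactor=> // i _ ->; exists i.
have [f_odd | f_even] := boolP (odd f).
  left; suff ->: f = 1%N by rewrite expn1.
  rewrite predn_exp in def_pred.
  have /pow2[[|i] def_i]: \sum_(i < f) p ^ i %| 2 ^ a by rewrite -def_pred dvdn_mull.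
    case: f f_odd def_i {def_v def_pred} => [|[|f]] // _.
    rewrite big_ord_recl big_ord_recl /= /bump /= expn0 expn1 => /eqP.
    by rewrite -[X in _ == X]addn0 eqn_add2l addn_eq0 => /andP[/eqP p0]; rewrite p0 in p_gt1.
  by have := odd_sum_expn f p_odd; rewrite def_i f_odd oddX.
right; have def_f: f = f./2.*2 by rewrite -[LHS]odd_double_half (negPf f_even).
set g := f./2 in def_f; have v2: (p ^ f)%N = (p ^ g * p ^ g)%N.
  by rewrite def_f -addnn expnD.
rewrite v2 in def_pred *; set x := (p ^ g)%N in def_pred *.
have x_gt0: 0 < x by rewrite expn_gt0 prime_gt0.
have def_xx: (x.-1 * x.+1)%N = (2 ^ a)%N by rewrite -def_pred; nia.
have [i def_i]: exists i, x.-1 = (2 ^ i)%N by apply: pow2; rewrite -def_xx dvdn_mulr.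
have [j def_j]: exists j, x.+1 = (2 ^ j)%N by apply: pow2; rewrite -def_xx dvdn_mull.
have ij: (2 ^ i + 2 = 2 ^ j)%N by rewrite -def_i -def_j; lia.
have i1: i = 1%N.
  case: i {def_i} ij => [|[|i]] // ij; case: j {def_j} ij => [|[|[|j]]]; rewrite ?expnS ?expn0; lia.
by have -> : x = 3; [move: def_i; rewrite i1; lia | ].
Qed.

Lemma index_cent1_pred (gT : finGroupType) (Y U : {group gT}) u :
  Y \subset 'N(U) -> u \in U^# -> #|Y : 'C_Y[u]| <= #|U|.-1.
Proof.
move=> nUY /setD1P[ntu Uu]; rewrite index_cent1 (cardsD1 1 U) group1 /=.
apply/subset_leq_card/subsetP=> _ /imsetP[y Yy ->].
by rewrite !inE -(inj_eq (conjg_inj y^-1)) conjgK conj1g ntu memJ_norm ?(subsetP nUY).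
Qed.

(* The section describes the case [q = 2] of [blocks], with [H = C_K(V1)]. *)
Section TwoGroup.

Variables (gT : finGroupType) (K V0 H : {group gT}) (p f a : nat).
Hypotheses (tK : 2.-group K) (abV : abelian V0) (nVK : K \subset 'N(V0)).
Hypotheses (p_pr : prime p) (p_odd : odd p) (oV : #|V0| = (p ^ f)%N).
Hypothesis irrV : forall U : {group gT},
  U \subset V0 -> U :!=: 1 -> K \subset 'N(U) -> U :=: V0.
Hypotheses (nsHK : H <| K) (tiHC : H :&: 'C_K(V0) = 1).
Hypotheses (oH : #|H| = (2 ^ a)%N) (LH1 : 'L_3(H) = 1).
Hypothesis cHKK : [~: H, K] \subset 'C(K).
Hypothesis sqrH : {in H, forall h, h ^+ 2 \in 'L_3(K) <*> 'C_K(V0)}.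
Hypothesis oKD : #|K : 'L_3(K) <*> 'C_K(V0)| = (2 ^ a)%N.
Hypotheses (ltV : 2 ^ a < #|V0|) (leV : #|V0| * #|V0| <= 2 * (2 ^ a * 2 ^ a)).
Hypothesis IH : forall Y U : {group gT}, #|U| < #|V0| ->
  nilpotent Y -> Y \subset 'N(U) -> abelian U -> coprime #|U| #|Y| ->
  U :!=: 1 -> #|Y : 'L_3(Y) <*> 'C_Y(U)| < #|U|.

Let C0 := 'C_K(V0)%G.
Let sHK : H \subset K := normal_sub nsHK.
Let nHK : K \subset 'N(H) := normal_norm nsHK.
Let nVH : H \subset 'N(V0) := subset_trans sHK nVK.

Lemma twog_V_gt1 : 1 < #|V0|.
Proof. by apply: leq_ltn_trans ltV; rewrite expn_gt0. Qed.

Lemma twog_coprime (Y U : {group gT}) :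
  Y \subset K -> U \subset V0 -> coprime #|U| #|Y|.
Proof.
move=> sYK sUV; apply: coprimeSg sUV (coprimegS sYK _).
by rewrite coprime_sym (pnat_coprime tK) // -odd_2'nat oV oddX p_odd orbT.
Qed.

Lemma twog_faithful w : w \in H -> w \in 'C(V0) -> w = 1.
Proof.
move=> Hw cw; apply/set1P; rewrite -[[set 1]]tiHC !inE Hw (subsetP sHK) //.
Qed.

Lemma twog_semireg w : w \in H -> w \in 'C(K) -> w != 1 -> 'C_V0[w] = 1.
Proof.
move=> Hw cwK ntw; apply/eqP; apply: contraNT ntw => ntC.
have defC: 'C_V0[w] = V0.
  apply: irrV; rewrite ?subsetIl // normsI // (subset_trans _ (normG _)) //.
  by apply/subsetP=> k Kk; apply/cent1P; apply/esym/(centP cwK).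
apply/eqP/twog_faithful => //; rewrite -sub_cent1 -defC; exact: subsetIr.
Qed.

Lemma twog_inverts w : w \in H -> w \in 'C(K) -> #[w] = 2 ->
  {in V0, forall v, v ^ w = v^-1}.
Proof.
move=> Hw cwK ow; apply: invol_inverts => //; first exact: (subsetP nVH).
by apply: twog_semireg => //; rewrite -order_eq1 ow.
Qed.

Lemma twog_inverts_uniq w z : w \in H -> z \in H ->
    {in V0, forall v, v ^ w = v^-1} -> {in V0, forall v, v ^ z = v^-1} ->
  w = z.
Proof.
move=> Hw Hz iw iz; apply/eqP; rewrite eq_mulgV1; apply/eqP.
apply: twog_faithful; first by rewrite groupM ?groupV.
apply/centP=> v Vv; apply/esym/commgP/conjg_fixP; rewrite conjgM iw //.
by rewrite -(iz v Vv) conjgK.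
Qed.

(** All nontrivial elements of [H] are then central involutions inverting [V0], so [H] has order at
    most 2 and the size bounds clash. *)
Lemma twog_lcn_central : 'L_3(K) \subset C0 -> H \subset 'C(K) -> False.
Proof.
move=> sDC cHK; have sqr1 h : h \in H -> h ^+ 2 = 1.
  move=> Hh; apply: twog_faithful; first exact: groupX.
  by have := sqrH Hh; rewrite (joing_idPr sDC) => /setIP[].
have le2: #|H| <= 2.
  have [H1 | /trivgPn[w Hw ntw]] := eqsVneq H 1; first by rewrite H1 cards1.
  have inv h : h \in H -> h != 1 -> {in V0, forall v, v ^ h = v^-1}.
    move=> Hh nth; apply: twog_inverts => //; first exact: (subsetP cHK).
    exact: nt_prime_order (sqr1 h Hh) nth.
  apply: (@leq_trans #|[set 1; w]|); last by rewrite cards2 eq_sym ntw.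
  apply/subset_leq_card/subsetP=> h Hh; rewrite !inE; have [//|nth /=] := eqVneq h 1.
  by apply/eqP; apply: twog_inverts_uniq => //; apply: inv.
have V_odd: odd #|V0| by rewrite oV oddX p_odd orbT.
rewrite oH in le2; move: le2 V_odd ltV leV.
move: (2 ^ a)%N (#|V0|) => A v; case: A => [|[|[|A]]] // _.
- by case: v.
- by case: v => [|[|[|v]]].
by move=> _ v_gt2; move/(leq_trans (leq_mul v_gt2 v_gt2)).
Qed.

(** A cyclic [V0] has abelian automorphism group, so commutators of [K] lie in [C0], which meets [H]
    trivially. *)
Lemma twog_not_prime : ~ prime #|V0|.
Proof.
move=> V_pr; have sK1C: K^`(1) \subset C0.
  rewrite subsetI der_sub /= -ker_conj_aut ker_trivg_morphim.
  rewrite (subset_trans (der_sub 1 K)) //= morphim_der //; apply/trivgP/commG1P.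
  apply: abelianS (Aut_conj_aut _ _) (Aut_cyclic_abelian _).
  exact: prime_cyclic.
apply: twog_lcn_central; first exact: subset_trans (lcn_sub_leq K (_ : 2 <= 3)) sK1C.
rewrite centsC; apply/commG1P/trivgP; rewrite -tiHC subsetI commg_subr nHK /=.
by rewrite (subset_trans _ sK1C) // commgS.
Qed.

(** The stabilizer [Y] of a nontrivial point has index at most 8, and acts on [V0] through
    [[~: V0, Y]], of order at most 3. *)
Lemma twog_index9 : #|V0| = 9 -> #|K : C0| <= 16.
Proof.
move=> oV9; have V_gt1 : 1 < #|V0| by rewrite oV9.
have [x0 Vx0 ntx0] : exists2 x, x \in V0 & x != 1.
  by apply/trivgPn; rewrite -cardG_gt1.
pose Y := 'C_K[x0]%G; have sYK: Y \subset K := subsetIl _ _.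
have leY: #|K : Y| <= 8 by rewrite -[8]/9.-1 -oV9 index_cent1_pred // !inE ntx0.
have nVY: Y \subset 'N(V0) := subset_trans sYK nVK.
have coVY := twog_coprime sYK (subxx V0).
have oU := coprime_abel_card nVY coVY abV; rewrite oV9 in oU.
have C_gt1: 1 < #|'C_V0(Y)|.
  rewrite cardG_gt1; apply/trivgPn; exists x0; rewrite // inE Vx0.
  by rewrite -sub_cent1 subsetIr.
have defC0: 'C_Y([~: V0, Y]) = C0.
  rewrite coprime_comm_faithful // -setIA; congr (_ :&: _); apply/setIidPr.
  by rewrite sub_cent1; apply: subsetP Vx0; rewrite centsC.
have sC0Y: C0 \subset Y by rewrite -defC0 subsetIl.
rewrite -(Lagrange_index sYK sC0Y) (leq_mul leY (_ : _ <= 2)) //.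
rewrite -defC0; set U := [~: V0, Y]%G.
have sUV: U \subset V0 by rewrite commg_subl.
have [U1 | /trivgPn[u Uu ntu]] := eqsVneq U 1.
  rewrite (_ : 'C_Y(U) = Y) ?indexgg //; apply/setIidPl.
  by rewrite centsC U1 sub1G.
have oU3: #|U| = 3.
  have: #|U| %| 9 by rewrite -oU dvdn_mulr.
  have: #|U| != 9.
    apply: contraTneq C_gt1 => oU9; rewrite -leqNgt -(leq_pmul2l (isT : 0 < 9)).
    by rewrite -{1}oU9 oU.
  have : 1 < #|U| by rewrite cardG_gt1; apply/trivgPn; exists u.
  have : #|U| <= 9 by rewrite -oV9 subset_leq_card.
  by case: #|U| => [|[|[|[|[|[|[|[|[|[|]]]]]]]]]].
have defU: U :=: <[u]>.
  apply/esym/eqP; rewrite eqEcard cycle_subG Uu oU3 -orderE.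
  have : #[u] %| 3 by rewrite -oU3 order_dvdG.
  by have := ntu; rewrite -order_eq1; case: #[u] => [|[|[|]]].
have -> : 'C_Y(U) = 'C_Y[u] by rewrite defU cent_cycle.
apply: leq_trans (index_cent1_pred _ (_ : u \in U^#)) _.
- exact: commg_normr.
- by rewrite !inE ntu.
by rewrite oU3.
Qed.

(** Here [H <*> C0] has index at most 2 in [K] and is central modulo [N]. So [K / N] is abelian,
    ['L_3(K)] lies in [C0] and [K = H * C0]; then [H] is central, against [twog_lcn_central]. *)
Lemma twog_not9 : #|V0| <> 9.
Proof.
move=> oV9; have A8: (2 ^ a)%N = 8.
  move: ltV leV; rewrite oV9; case: (a) => [|[|[|[|b]]]] //.
  by rewrite ltnNge (@leq_trans (2 ^ 4)) // leq_pexp2l.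
have sC0: C0 \subset 'L_3(K) <*> C0 := joing_subr _ _.
have sDC: 'L_3(K) <*> C0 \subset K by rewrite join_subG lcn_sub subsetIl.
have nC0K: K \subset 'N(C0) by rewrite normsI ?normG ?norms_cent.
have le16 := twog_index9 oV9.
have oHC: #|H <*> C0 : C0| = 8.
  rewrite /= joingC norm_joinEr ?(subset_trans sHK) // indexMg -indexgI tiHC.
  by rewrite indexg1 oH.
have sHCK: H <*> C0 \subset K by rewrite join_subG sHK subsetIl.
have oKHC: (#|K : H <*> C0| * 8)%N = #|K : C0|.
  by rewrite -oHC Lagrange_index ?joing_subr.
have le2: #|K : H <*> C0| <= 2 by rewrite -(leq_pmul2r (isT : 0 < 8)) oKHC.
pose N := ([~: H, K] <*> C0)%G.
have nNK: K \subset 'N(N) by rewrite normsY ?commg_normr.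
have abKN: abelian (K / N).
  apply: (@cyclic_factor_abelian _ (H <*> C0 / N)%G).
    have defHC: H <*> C0 = H * C0 := norm_joinEl (subset_trans sHK nC0K).
    rewrite subsetI quotientS //= defHC quotientMl ?(subset_trans sHK) // mul_subG //.
      by rewrite quotient_cents2r ?joing_subl.
    by rewrite quotientS1 ?sub1G ?joing_subr.
  have: #|K / N / (H <*> C0 / N)| <= 2.
    rewrite card_quotient ?quotient_norms ?normsY //.
    apply: leq_trans le2; rewrite dvdn_leq // index_quotient //.
    by rewrite subIset ?nNK.
  case E: #|_| => [|[|[|]]] // _; last by rewrite prime_cyclic ?E.
    by move: (cardG_gt0 (K / N / (H <*> C0 / N))); rewrite E.
  by rewrite (card1_trivg E) cyclic1.
have sDC0: 'L_3(K) \subset C0.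
  have sK1N: K^`(1) \subset N by apply: der1_min.
  apply: subset_trans (commSg K sK1N) _.
  have RK1: [~: H, K, K] = 1 by apply/commG1P.
  rewrite /= norm_joinEr ?(subset_trans (comm_subG sHK (subxx K))) //; last first.
    by rewrite (subset_trans (subsetIl _ _)) ?commg_normr.
  rewrite commMG; last by rewrite RK1 norms1.
  by rewrite RK1 mul1g commg_subl.
have oK8: #|K : C0| = 8 by rewrite -A8 -oKD /= (joing_idPr sDC0).
have defK: H <*> C0 = K.
  apply/eqP; rewrite eqEsubset sHCK -indexg_eq1 -(eqn_pmul2r (isT : 0 < 8)).
  by rewrite oKHC oK8.
apply: twog_lcn_central => //.
have cHC: H \subset 'C(C0).
  have: [~: H, C0] \subset H :&: 'C_K(V0).
    rewrite subsetI commg_subl commg_subr (subset_trans sHK nC0K) andbT.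
    by rewrite (subset_trans (subsetIl _ _)).
  by rewrite tiHC => /trivgP/commG1P.
rewrite -defK centY subsetI cHC andbT.
apply: abelem_abelian (exponent2_abelem _); apply/exponentP=> h Hh.
apply: twog_faithful; first exact: groupX.
by have := sqrH Hh; rewrite (joing_idPr sDC0) => /setIP[].
Qed.

Lemma twog_comm_invol y k : y \in H -> y ^+ 2 = 1 -> k \in K ->
  [/\ [~ y, k] \in H, [~ y, k] \in 'C(K) & [~ y, k] ^+ 2 = 1].
Proof.
move=> Hy y2 Kk; have HKyk: [~ y, k] \in [~: H, K] by rewrite mem_commg.
have cyk := subsetP cHKK _ HKyk; split=> //.
  by apply: subsetP HKyk; rewrite commg_subl.
have cyyk: commute y [~ y, k] by apply/esym/(centP cyk)/(subsetP sHK).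
have: (y ^ k) ^+ 2 = 1 by rewrite -conjXg y2 conj1g.
by rewrite conjg_mulR expgMn // y2 mul1g.
Qed.

Lemma twog_central_invol z w : z \in H -> z \in 'C(K) -> #[z] = 2 ->
  w \in H -> w \in 'C(K) -> w ^+ 2 = 1 -> w \in [set 1; z].
Proof.
move=> Hz cz oz Hw cw w2; rewrite !inE; have [//|ntw /=] := eqVneq w 1.
apply/eqP/twog_inverts_uniq => //; apply: twog_inverts => //.
exact: nt_prime_order w2 ntw.
Qed.

(* Otherwise [z = [y, k]] is a central involution inverting [V0], so [V0] splits as
   [C(y) * C(y ^ k)] with both factors isomorphic to [U], and counting [H] on [U]
   leaves only [#|V0| = 9]. *)
Lemma twog_involution_central y : y \in H -> #[y] = 2 -> y \in 'C(K).
Proof.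
move=> Hy oy; have y2: y ^+ 2 = 1 by rewrite -oy expg_order.
have Ky := subsetP sHK y Hy; have nVy := subsetP nVH y Hy.
rewrite -sub_cent1; apply/idPn=> /subsetPn[k Kk nyk].
have ntz: [~ y, k] != 1 by apply: contra nyk => /commgP cyk; apply/cent1P.
have [Hz cz z2] := twog_comm_invol Hy y2 Kk.
set z := [~ y, k] in ntz Hz cz z2; have oz: #[z] = 2 := nt_prime_order (isT : prime 2) z2 ntz.
have defyk: y ^ k = y * z by rewrite conjg_mulR.
have iz := twog_inverts Hz cz oz.
have Cz1 := twog_semireg Hz cz ntz.
pose U := 'C_V0[y]%G; have sUV: U \subset V0 := subsetIl _ _.
have nVk := subsetP nVK k Kk.
have defUk: U :^ k = 'C_V0[y ^ k] by rewrite /= conjIg (normP nVk) cent1J.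
have sUkV: U :^ k \subset V0 by rewrite defUk subsetIl.
have tiUU: U :&: U :^ k = 1.
  apply/trivgP; suff: U :&: U :^ k \subset 'C_V0[z] by rewrite Cz1.
  rewrite defUk; apply/subsetP=> w /setIP[/setIP[Vw cwy] /setIP[_ cwyk]].
  by rewrite inE Vw /z commgEl cent1C groupM ?groupV // cent1C.
have leUU: #|U| * #|U| <= #|V0|.
  rewrite -{2}(cardJg U k) -TI_cardMg // subset_leq_card //.
  exact: mul_subG.
have ntU: U :!=: 1.
  apply: contra nyk => /eqP/= C1; have iy := invol_inverts abV nVy oy C1.
  have cy: y \in 'C(K) by rewrite (twog_inverts_uniq Hy Hz iy iz).
  by apply: subsetP Kk; rewrite sub_cent1.
have U_gt1: 1 < #|U| by rewrite cardG_gt1.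
have ltUV: #|U| < #|V0| by apply: leq_trans leUU; rewrite ltn_Pmulr // ltnW.
have nVY: <[y]> \subset 'N(V0) by rewrite cycle_subG.
(* Both [y] and [z] invert each [[~ w, y]], so [y ^ k = y * z] fixes it. *)
have genV: V0 \subset U <*> U :^ k.
  have coVY: coprime #|V0| #|<[y]>| by apply: twog_coprime; rewrite ?cycle_subG.
  have defV := coprime_comm_cent_mul nVY coVY (abelian_sol abV).
  suff: [~: V0, <[y]>] * 'C_V0(<[y]>) \subset U <*> U :^ k by rewrite defV.
  rewrite cent_cycle mul_subG ?joing_subl //.
  apply: subset_trans (joing_subr U _); rewrite defUk gen_subG.
  apply/subsetP=> _ /imset2P[w y' Vw /= Yy' ->].
  move: Yy'; rewrite cycle2g // => /set2P[]-> {y'}.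
    by rewrite commg1 group1.
  have Vwy: w ^ y \in V0 by rewrite memJ_norm.
  have Vc: [~ w, y] \in V0 by rewrite commgEl groupM ?groupV.
  rewrite inE Vc /=; apply/cent1P/commgP/conjg_fixP; rewrite defyk conjgM.
  rewrite iz ?memJ_norm // commgEl conjMg conjVg -conjgM.
  by rewrite -[y * y]/(y ^+ 2) y2 conjg1 invMg invgK.
pose Hy' := 'C_H[y]%G.
have leHy: #|H : Hy'| <= 2.
  rewrite index_cent1; apply: (@leq_trans #|[set y; y * z]|).
    apply/subset_leq_card/subsetP=> _ /imsetP[h Hh ->].
    have [Hs cs s2] := twog_comm_invol Hy y2 (subsetP sHK h Hh).
    have := twog_central_invol Hz cz oz Hs cs s2; rewrite conjg_mulR.
    by rewrite !inE => /orP[/eqP->|/eqP->]; rewrite ?mulg1 eqxx ?orbT.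
  by rewrite cards2; case: (y != _).
pose Y1 := 'C_Hy'(U)%G.
(* For [w] in [Y1] write [w ^ k = w * s] with [s] central. As [k * k] normalizes [U], [s * s]
   centralizes [U] and is trivial, so [s] is [1] or [z]; accordingly [w] agrees with [1] or [y] on
   [U] and on [U :^ k]. *)
have leY1: #|Y1| <= 2.
  apply: (@leq_trans #|[set 1; y]|); last by rewrite cards2; case: (1 != _).
  apply/subset_leq_card/subsetP=> w /setIP[/setIP[Hw cwy] cwU].
  have HKwk: [~ w, k] \in [~: H, K] by rewrite mem_commg.
  have cs := subsetP cHKK _ HKwk; set s := [~ w, k] in HKwk cs.
  have Hs: s \in H by apply: subsetP HKwk; rewrite commg_subl.
  have defwk: w ^ k = w * s by rewrite conjg_mulR.
  have cwUk: w * s \in 'C(U :^ k) by rewrite -defwk centJ memJ_conjg.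
  have csk: s ^ k = s by apply/conjg_fixP/commgP/(centP cs).
  have czk: z ^ k = z by apply/conjg_fixP/commgP/(centP cz).
  have defU: U :^ (k * k) = U.
    rewrite conjsgM defUk conjIg (normP nVk) -cent1J defyk conjMg czk defyk.
    by rewrite -mulgA -[z * z]/(z ^+ 2) z2 mulg1.
  have cssU: s * s \in 'C(U).
    have: w ^ (k * k) \in 'C(U) by rewrite -defU centJ memJ_conjg.
    by rewrite conjgM defwk conjMg csk defwk -mulgA groupMl.
  have s2: s ^+ 2 = 1.
    apply/eqP; apply: contraNT ntU => nts2.
    have := twog_semireg (groupM Hs Hs) (groupM cs cs) nts2.
    move/trivgP; rewrite -subG1; apply: subset_trans.
    by rewrite subsetI sUV sub_cent1.
  have faith x : x \in H -> x \in 'C(U) -> x \in 'C(U :^ k) -> x = 1.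
    move=> Hx cxU cxUk; apply: twog_faithful => //.
    apply: subsetP (centS genV) _ _; by rewrite centY inE cxU.
  rewrite !inE; case/set2P: (twog_central_invol Hz cz oz Hs cs s2) => def_s.
    by rewrite (faith w) ?eqxx //; rewrite def_s mulg1 in cwUk.
  apply/orP; right; rewrite eq_mulgV1; apply/eqP/faith.
  - by rewrite groupM ?groupV.
  - by rewrite groupM ?groupV // -sub_cent1 subsetIr.
  have -> : w * y^-1 = (w * s) * (y * z)^-1.
    by rewrite def_s invMg mulgA mulgK.
  by rewrite groupM ?groupV // -defyk -sub_cent1 defUk subsetIr.
have leHY: #|Hy' : Y1| <= #|U|.-1.
  have sHyK: Hy' \subset K := subset_trans (subsetIl _ _) sHK.
  rewrite -ltnS prednK ?cardG_gt0 //; have := IH ltUV (nilpotentS sHyK (pgroup_nil tK)).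
  have -> : 'L_3(Hy') = 1 by apply/trivgP; rewrite -[[1]]LH1 lcnS ?subsetIl.
  rewrite joing1G; apply=> //; first 1 last.
  - exact: abelianS abV.
  - exact: twog_coprime.
  apply: normsI; first exact: subset_trans sHyK nVK.
  exact: subset_trans (subsetIr _ _) (normG _).
apply: twog_not9; apply: (@nine_arith #|U| _ (2 ^ a)) => //.
- by apply: dvdn_odd (cardSg sUV) _; rewrite oV oddX p_odd orbT.
- exact: cardSg.
- by rewrite oV oddX p_odd orbT.
rewrite -oH -(Lagrange (subsetIl H 'C[y])) -(Lagrange (subsetIl Hy' 'C(U))).
rewrite (_ : 4 * _ = 2 * #|U|.-1 * 2)%N; last by rewrite mulnAC.
by rewrite leq_mul // leq_mul.
Qed.

(** Involutions of [H] are central, hence fixed point free, so [H] acts semiregularly and [2 ^ a]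
    divides [#|V0|.-1]. By size [#|V0| = 2 ^ a + 1], which is a prime or 9. *)
Lemma twog_contra : False.
Proof.
have V_odd: odd #|V0| by rewrite oV oddX p_odd orbT.
have regH: semiregular V0 H.
  move=> h /setD1P[nt_h Hh]; have tH := pgroupS sHK tK.
  have [m oh]: {m | #[h] = (2 ^ m)%N} by apply: p_natP; apply: mem_p_elt tH Hh.
  have m_gt0: 0 < m by case: m oh nt_h => // oh; rewrite -order_eq1 oh.
  set w := h ^+ (2 ^ m.-1).
  have ow: #[w] = 2.
    by rewrite orderXdiv oh ?dvdn_exp2l ?leq_pred // -{1}[m]prednK // expnS mulnK ?expn_gt0.
  have Hw: w \in H by rewrite groupX.
  have cw := twog_involution_central Hw ow.
  apply/trivgP; suff: 'C_V0[h] \subset 'C_V0[w].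
    by rewrite (twog_semireg Hw cw _) // -order_eq1 ow.
  apply/setIS/subsetP=> x /cent1P cxh; apply/cent1P; exact: commuteX.
have oVa: #|V0| = (2 ^ a).+1.
  apply: pred_dvd_arith; [exact: twog_V_gt1 | rewrite -oH | exact: leV].
  exact: regular_norm_dvd_pred.
case: (expn_pred_pow2 p_pr p_odd (etrans (esym oV) oVa)); rewrite -oV.
  exact: twog_not_prime.
exact: twog_not9.
Qed.

End TwoGroup.

Lemma even_blocks_bound (gT : finGroupType) (G V K V0 V1 : {group gT})
    (t : gT) :
    2.-group G -> abelian V -> coprime #|V| #|G| -> minnormal V G ->
    'C_G(V) = 1 -> blocks G V 2 K V0 V1 t ->
    (forall Y U : {group gT}, #|U| < #|V| ->
      nilpotent Y -> Y \subset 'N(U) -> abelian U -> coprime #|U| #|Y| ->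
      U :!=: 1 -> #|Y : 'L_3(Y) <*> 'C_Y(U)| < #|U|) ->
  #|G : 'L_3(G)| < #|V|.
Proof.
move=> tG abV coVG minV cGV1 bl IH; rewrite ltnNge; apply/negP=> full.
have [ntV nVG] := andP (mingroupp minV); have pr2 : prime 2 by [].
have [eqL _] := full_blocks_lcn tG abV coVG nVG cGV1 pr2 bl IH full.
have leV0 := full_blocks_card tG abV coVG nVG cGV1 pr2 bl IH full.
have [tiHD oH] := full_blocks_H tG abV coVG nVG cGV1 pr2 bl IH full.
have oC0 := full_blocks_C0 tG abV coVG nVG cGV1 pr2 bl IH full.
have tiHC := blocks_tiHC0 cGV1 bl.
have conjH := blocks_conjH bl.
have V0gt1 := blocks_V0_gt1 pr2 bl.
have [ltV0 _] := andP (blocks_log_bounds pr2 bl).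
move: ltV0 leV0 tiHD oH oC0; set a := trunc_log 2 _.
set H := 'C_K(V1)%G; set C0 := 'C_K(V0)%G.
rewrite -/H -/C0 in tiHC conjH; move=> ltV0 leV0 tiHD oH oC0.
have [sKG nKG] := andP (bl_norm bl).
have nsC0K: C0 <| K.
  by rewrite /normal subsetIl normsI ?normG ?norms_cent ?(bl_nV0 bl).
have nsHK: H <| K.
  by rewrite /normal subsetIl normsI ?normG ?norms_cent ?(bl_nV1 bl).
have [[sHK nHK] [sC0K nC0K]] := (andP nsHK, andP nsC0K).
have tK := bl_t bl; have [Gt nKt] := setDP tK.
have cHC0: H \subset 'C(C0).
  have: [~: H, C0] \subset H :&: C0.
    rewrite subsetI commg_subl commg_subr (subset_trans sHK nC0K) andbT.
    exact: subset_trans sC0K nHK.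
  by rewrite tiHC => /trivgP/commG1P.
have Kt2: t * t \in K.
  have Nt := subsetP nKG t Gt.
  apply: coset_idr; first by rewrite groupM.
  have: #|G / K| = 2 by rewrite card_quotient ?(bl_index bl).
  by move=> oGK; rewrite morphM // -[_ * _]/(_ ^+ 2) -{1}oGK expg_cardG ?mem_quotient.
(* Since [h ^ t] lies in [C0], which commutes with [H], [[~ h, t, t]] equals
   [h * h ^ (t * t) * (h ^ t) ^- 2]; it lies in ['L_3(G) = 'L_3(K)], and conjugation by [t^-1]
   isolates [h ^+ 2]. *)
have sqrH: {in H, forall h, h ^+ 2 \in 'L_3(K) <*> C0}.
  move=> h Hh; have Gh := subsetP (subset_trans sHK sKG) h Hh.
  have Dx: [~ h, t, t] ^ t^-1 \in 'L_3(K).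
    rewrite -eqL memJ_norm ?(subsetP (lcn_norm 3 G)) ?groupV //.
    by rewrite !lcnSn !mem_commg.
  have Cht: h ^ t \in C0 by rewrite (subsetP (conjH t tK)) ?memJ_conjg.
  have Htt: h ^ (t * t) \in H by rewrite memJ_norm ?(subsetP nHK).
  have Ct: (h * h ^ (t * t)) ^ t^-1 \in C0.
    have tVK: t^-1 \in G :\: K by apply/setDP; rewrite !groupV.
    by apply: (subsetP (conjH _ tVK)); rewrite memJ_conjg; apply: groupM.
  have defx: [~ h, t, t] = h * h ^ (t * t) * (h ^ t) ^- 2.
    have c1 : commute h (h ^ t)^-1 := centsP cHC0 h Hh _ (groupVr Cht).
    have c2 : commute (h ^ (t * t)) (h ^ t)^-1 := centsP cHC0 _ Htt _ (groupVr Cht).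
    rewrite commgEl commgEl conjMg conjVg -conjgM.
    move: (h ^ t) (h ^ (t * t)) c1 c2 => u w c1 c2; rewrite invMg invgK.
    rewrite -[u ^- 2]/((u * u)^-1) invMg; move: (u^-1) c1 c2 => v c1 c2.
    by rewrite -c1 -c2 -!mulgA (mulgA v w v) -c2 -!mulgA.
  have -> : h ^+ 2 = ([~ h, t, t] ^ t^-1)^-1 * (h * h ^ (t * t)) ^ t^-1.
    rewrite defx conjMg invMg mulgKV -conjVg invgK conjXg conjgK //.
  have sD := subsetP (joing_subl 'L_3(K) C0).
  have sC := subsetP (joing_subr 'L_3(K) C0).
  exact: groupM (groupVr (sD _ Dx)) (sC _ Ct).
have sH1: H^`(1) \subset 'L_3(K) <*> C0.
  rewrite gen_subG; apply/subsetP=> _ /imset2P[x y Hx Hy ->].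
  have -> : [~ x, y] = x ^- 2 * (x * y^-1) ^+ 2 * y ^+ 2.
    rewrite -[y ^+ 2]/(y * y) -[x ^- 2]/((x * x)^-1).
    rewrite -[_ ^+ 2]/(x * y^-1 * (x * y^-1)) commgEl conjgE invMg.
    by rewrite !mulgA mulgKV mulgKV.
  apply: groupM (sqrH _ Hy); apply: groupM (groupVr (sqrH _ Hx)) (sqrH _ _).
  exact: groupM Hx (groupVr Hy).
have sDH: 'L_3(K) <*> C0 \subset K by rewrite join_subG lcn_sub sC0K.
have cR: [~: H, K, K] \subset 'L_3(H).
  have sRH: [~: H, K] \subset H by rewrite commg_subl.
  rewrite -tiHD subsetI (subset_trans (commSg K sRH)) //=.
  by rewrite lcnSn commSg // commSg.
(* Commutators of [H] are products of squares, so ['L_3(H)] lies in [[~: 'L_3(K), H]], hence in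
   [[~: H, K, K, K]] and in [[~: 'L_3(H), K]]; nilpotence of [K] makes it trivial. *)
have LH1: 'L_3(H) = 1.
  apply/eqP; apply/idPn=> ntL.
  have nilK : nilpotent K := pgroup_nil (pgroupS sKG tG).
  have nLK: K \subset 'N('L_3(H)) by apply: char_norm_trans (lcn_char 3 H) nHK.
  have sLK: 'L_3(H) \subset K := subset_trans (lcn_sub 3 H) sHK.
  have := nil_comm_properl nilK sLK ntL (_ : K \subset 'N_K('L_3(H))).
  rewrite subsetI subxx nLK => /(_ isT)/proper_subn/negP; apply.
  have sL: 'L_3(H) \subset [~: 'L_3(K) <*> C0, H] by rewrite lcnSn commSg.
  apply: subset_trans sL _; rewrite norm_joinEr; last first.
    by rewrite (subset_trans sC0K) ?lcn_norm.
  rewrite commMG; last by rewrite (subset_trans sC0K) // normsR ?lcn_norm.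
  have -> : [~: C0, H] = 1 by apply/commG1P; rewrite centsC.
  rewrite mulg1; apply: subset_trans (comm_lcn3_sub nsHK) _; exact: commSg.
have oH2: #|H| = (2 ^ a)%N by rewrite -oH LH1 indexg1.
have [_ _] := minnormal_solvable minV (subxx V) (abelian_sol abV).
case/is_abelemP=> p p_pr abelV; have pV := abelem_pgroup abelV.
have [f oV0] := p_natP (pgroupS (bl_sub bl) pV).
have V0_odd : odd #|V0|.
  apply: dvdn_odd (cardSg (bl_sub bl)) _.
  rewrite -coprimen2 (coprime_dvdr _ coVG) // -(bl_index bl) dvdn_indexg //.
have f_gt0 : 0 < f by case: f oV0 V0gt1 => // ->.
have p_odd: odd p by move: V0_odd; rewrite oV0 oddX eqn0Ngt f_gt0.
have sV0V := bl_sub bl.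
apply: (@twog_contra _ K V0 H p f a) => //.
- exact: pgroupS sKG tG.
- exact: abelianS abV.
- exact: bl_nV0 bl.
- exact: bl_irr bl.
- by apply/commG1P/trivgP; rewrite -[[1]]LH1.
- by move: leV0; rewrite -mulnn [leqRHS]expnS expnM -[((2 ^ a) ^ 2)%N]mulnn.
move=> Y U ltU; apply: IH; apply: leq_trans ltU _; exact: subset_leq_card.
Qed.

(** * The coprime nilpotent bound *)

(** Working modulo the kernel lets the induction apply to submodules and blocks on which the acting
    group is not faithful. *)
Theorem nilpotent_class2_bound (gT : finGroupType) (G V : {group gT}) :
    nilpotent G -> G \subset 'N(V) -> abelian V -> coprime #|V| #|G| ->
    V :!=: 1 ->
  #|G : 'L_3(G) <*> 'C_G(V)| < #|V|.
Proof.
have [n] := ubnP #|V|.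
elim: n gT G V => // n IHn gT G V ltVn.
wlog cGV1: gT G V ltVn / 'C_G(V) = 1 => [IHf|].
  move=> nilG nVG abV coVG ntV.
  have tiGV: G :&: V = 1 by rewrite setIC coprime_TIg.
  have oVC := card_quotient_cent tiGV.
  have := IHf _ (G / 'C_G(V))%G (V / 'C_G(V))%G.
  rewrite /= (cent_quotient_cent nVG tiGV) joingG1 oVC index_quotient_cent //.
  apply=> //.
  - exact: quotient_nil.
  - exact: norm_quotient_cent.
  - exact: quotient_abelian.
  - exact: coprime_dvdr (dvdn_quotient _ _) coVG.
  by rewrite -cardG_gt1 /= oVC cardG_gt1.
move=> nilG nVG abV coVG ntV; rewrite cGV1 joingG1.
have IH (Y U : {group gT}) : #|U| < #|V| -> nilpotent Y -> Y \subset 'N(U) ->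
    abelian U -> coprime #|U| #|Y| -> U :!=: 1 ->
    #|Y : 'L_3(Y) <*> 'C_Y(U)| < #|U|.
  by move=> ltUV; apply: IHn; apply: leq_trans ltUV _.
have [minV | nminV] := boolP (minnormal V G); last first.
  have [V1 [ltV1 ntV1 nV1G]] := not_minnormal_sub nVG ntV nminV.
  set C1 := 'C_G(V1)%G; pose V2 := [~: V, C1]%G.
  have sC1G : C1 \subset G := subsetIl _ _.
  have nVC1 : C1 \subset 'N(V) := subset_trans sC1G nVG.
  have coVC1 : coprime #|V| #|C1| := coprimegS sC1G coVG.
  have oV := coprime_abel_card nVC1 coVC1 abV.
  have sV1C : V1 \subset 'C_V(C1).
    by rewrite subsetI (proper_sub ltV1) centsC subsetIr.
  have leV1C := subset_leq_card sV1C.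
  have V1gt1 : 1 < #|V1| by rewrite cardG_gt1.
  have sV2V : V2 \subset V by rewrite commg_subl.
  have ltV2 : V2 \proper V.
    rewrite properEcard sV2V -oV.
    by rewrite ltn_Pmulr // (leq_trans V1gt1).
  have cV2 : 'C_C1(V2) = 1.
    rewrite coprime_comm_faithful //; apply/trivgP.
    suff: 'C_C1(V) \subset 'C_G(V) by rewrite cGV1.
    by rewrite setSI.
  have lt1 := IH G V1 (proper_card ltV1) nilG nV1G (abelianS (proper_sub ltV1) abV)
    (coprimeSg (proper_sub ltV1) coVG) ntV1.
  have leG : #|G : 'L_3(G)| <= #|G : 'L_3(G) <*> C1| * #|C1 : 'L_3(C1)|.
    rewrite -[X in #|C1 : X|]joingG1 -[X in #|G : X|]joingG1.
    apply: index_join_leq; rewrite ?sub1G ?lcn_normal ?lcnS ?lcn_sub //.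
    by rewrite normsI ?normG ?norms_cent.
  apply: leq_ltn_trans leG _; rewrite -oV mulnC.
  (* [V2] may be trivial, so this bound is only weak; strictness comes from [V1]. *)
  have le2 : #|C1 : 'L_3(C1)| <= #|V2|.
    have [V21 | ntV2] := eqsVneq V2 1.
      have C11 : C1 :=: 1.
        by rewrite -[RHS]cV2 V21; apply/esym/setIidPl; rewrite centsC sub1G.
      apply: (@leq_trans #|C1|); last by rewrite C11 cards1 cardG_gt0.
      by rewrite dvdn_leq ?cardG_gt0 // -(Lagrange (lcn_sub 3 C1)) dvdn_mull.
    have := IH C1 V2 (proper_card ltV2) (nilpotentS sC1G nilG) (commg_normr _ _)
      (abelianS sV2V abV) (coprimeSg sV2V coVC1) ntV2.
    by rewrite cV2 joingG1 => /ltnW.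
  apply: (@leq_ltn_trans (#|V2| * #|G : 'L_3(G) <*> C1|)).
    by rewrite leq_mul2r le2 orbT.
  rewrite ltn_pmul2l ?cardG_gt0 //; exact: leq_trans lt1 leV1C.
(* Bounding [q] makes the condition decidable; beyond [#|G|] the [q]-core is trivial. *)
have [rank1G | nrank1] := boolP [forall q : 'I_#|G|.+1, forall X : {group gT}, (X <| 'O_q(G)) && abelian X ==> cyclic X].
  apply: rank1_class2_bound => // q X nsX abX.
  have [ltqG | leGq] := ltnP q #|G|.+1.
    by have /forallP/(_ X)/implyP := forallP rank1G (Ordinal ltqG); apply; rewrite nsX.
  have [Oq1 | ntOq] := eqsVneq 'O_q(G) 1.
    by have := normal_sub nsX; rewrite Oq1 => /trivgP->; apply: cyclic1.
  have [_ q_dv _] := pgroup_pdiv (pcore_pgroup q G) ntOq.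
  have := dvdn_leq (cardG_gt0 _) q_dv.
  by rewrite leqNgt (leq_ltn_trans (subset_leq_card (pcore_sub q G)) leGq).
have [q [X [nsX abX ncX]]] : exists q : nat, exists X : {group gT}, [/\ X <| 'O_q(G), abelian X & ~~ cyclic X].
  move: nrank1; rewrite negb_forall => /existsP[q]; rewrite negb_forall => /existsP[X].
  by rewrite negb_imply => /andP[/andP[? ?] ?]; exists q, X.
have [q_pr [K [V0 [V1 [t [bl sTK]]]]]] := blocks_exist nilG abV coVG minV cGV1 nsX abX ncX.
have [T1 | ntT] := eqVneq 'O_q^'(G) 1; last exact: mixed_blocks_bound bl sTK IH ntT.
have qG : q.-group G.
  have := nilpotent_pcoreC q nilG; rewrite T1 dprodg1 => <-; exact: pcore_pgroup.
have [q2 | q_odd] := even_prime q_pr; last exact: odd_blocks_bound bl IH.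
by rewrite q2 in qG bl; apply: even_blocks_bound bl IH.
Qed.

(** * Solvable groups with trivial p-core *)

Section FittingTools.

Variable gT : finGroupType.
Implicit Types A B C D G H K N P : {group gT}.

(** Otherwise a minimal normal subgroup [M / Z] of [G / Z] inside [C / Z] is abelian; as [Z] is
    central in [C], [M] has class at most 2 and so lies in the Fitting subgroup. *)
Lemma solvable_cent_Fitting G : solvable G -> 'C_G('F(G)) \subset 'F(G).
Proof.
move=> solG; set C := 'C_G('F(G))%G; set Z := (C :&: 'F(G))%G.
have nsCG : C <| G by rewrite /normal subsetIl normsI ?normG ?norms_cent ?gFnorm.
have nsZG : Z <| G by rewrite normalI ?gFnormal.
have [sZG nZG] := andP nsZG; have [sCG nCG] := andP nsCG.
have nZC := subset_trans sCG nZG.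
have [sCZ|nsCZ] := boolP (C \subset Z); first exact: subset_trans sCZ (subsetIr _ _).
have ntCZ : (C / Z)%G :!=: 1.
  by apply: contra nsCZ => /eqP CZ1; rewrite -(quotient_sub1 nZC) CZ1.
have [Mb minM sMC] := minnormal_exists ntCZ (quotient_norms Z nCG).
have [nMG ntM abM] := minnormal_solvable minM sMC (quotient_sol _ (solvableS sCG solG)).
have [M defM sZM sMC'] := inv_quotientS (normalS (subsetIl _ _) sCG nsZG) sMC.
have nsMG : M <| G.
  have nsMb : M / Z <| G / Z by rewrite /normal -defM nMG (subset_trans sMC) ?quotientS.
  rewrite -(quotientGK nsZG) -(quotientGK (normalS sZM (subset_trans sMC' sCG) nsZG)).
  by rewrite cosetpre_normal.
have sMZ : M \subset Z.
  rewrite subsetI sMC' /=; apply: Fitting_max nsMG _.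
  apply/lcnP; exists 2; apply/commG1P.
  have sM'Z : 'L_2(M) \subset Z.
    rewrite lcn2 der1_min ?(subset_trans sMC') //= -defM.
    exact: abelem_abelian abM.
  apply: subset_trans (subset_trans sM'Z (subsetIr _ _)) _.
  by rewrite centsC (subset_trans sMC') ?subsetIr.
by case/negP: ntM; rewrite defM; apply/eqP; rewrite quotientS1.
Qed.

Lemma coprime_Phi_cent (p : nat) A D :
    p.-group D -> A \subset 'N(D) -> coprime #|D| #|A| ->
  [~: D, A] \subset 'Phi(D) -> A \subset 'C(D).
Proof.
move=> pD nDA coDA sRPhi.
suff defD : 'C_D(A) = D by rewrite centsC -defD subsetIr.
rewrite -[RHS](@Phi_nongen _ _ 'C_D(A)) ?genGid //.
apply/eqP; rewrite eqEsubset join_subG Phi_sub subsetIl /=.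
rewrite -{1}(coprime_comm_cent_mul nDA coDA (pgroup_sol pD)).
by rewrite mulG_subG joing_subr (subset_trans sRPhi) ?joing_subl.
Qed.

(* [[D, B]] is a proper subgroup of [D], so [A] centralizes it by induction, and
   the three subgroup lemma puts [[D, A]] in [C_D(B)]. *)
Lemma coprime_cent_AxB (p : nat) A B D :
    p.-group D -> p.-group B -> p^'.-group A ->
    A \subset 'N(D) -> B \subset 'N(D) -> A \subset 'C(B) ->
  A \subset 'C('C_D(B)) -> A \subset 'C(D).
Proof.
move=> + pB p'A + + cAB.
have [n] := ubnP #|D|; elim: n D => // n IHn D ltD pD nDA nDB cACD.
have solD := pgroup_sol pD.
have coDA : coprime #|D| #|A| := pnat_coprime pD p'A.
have [D1 | ntD] := eqsVneq D 1; first by rewrite D1 cents1.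
pose M := [~: D, B]%G.
have sMD : M \subset D by rewrite commg_subl.
have nMA : A \subset 'N(M) by rewrite normsR // cents_norm.
have ltM : M \proper D.
  have pDB : p.-group (D <*> B).
    by rewrite norm_joinEr // pgroupM pD.
  rewrite properEneq sMD andbT; apply: contraNneq ntD => defM.
  have /lcnP[k Lk] := pgroup_nil pDB.
  have sDL i : D \subset 'L_i.+1(D <*> B).
    elim: i => [|i IHi]; first by rewrite lcn1 joing_subl.
    by rewrite lcnSn -{1}defM commgSS ?joing_subr.
  by rewrite -subG1 -Lk.
have cAM : A \subset 'C(M).
  apply: IHn => //; first exact: leq_trans (proper_card ltM) _.
  - exact: pgroupS sMD pD.
  - exact: commg_normr.
  by apply: subset_trans cACD (centS _); rewrite setSI.
have R1 : [~: D, A, B] = 1.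
  rewrite [[~: D, A]]commGC; apply: three_subgroup.
    rewrite [[~: D, B]]commGC -/(gval M); apply/commG1P.
    by rewrite [[~: B, D]]commGC centsC.
  by have /commG1P-> : B \subset 'C(A); rewrite ?comm1G // centsC.
apply: (coprime_stab nDA coDA solD).
rewrite centsC; apply: subset_trans cACD (centS _).
by rewrite subsetI commg_subl nDA; apply/commG1P.
Qed.

(** A minimal supplement [H] works: for a Sylow subgroup [P] of [H], [(N :&: H) <*> P] is normal in
    [H], so by the Frattini argument ['N_H(P)] is a supplement too, and minimality makes [P]
    normal. *)
Lemma nilpotent_supplement G N :
    N <| G -> nilpotent (G / N) ->
  exists H : {group gT}, [/\ H \subset G, N * H = G & nilpotent H].
Proof.
move=> nsNG nilGN; have [sNG nNG] := andP nsNG.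
have [|H minH sHG] := @mingroup_exists _ (fun H : {group gT} => N * H == G) G.
  by rewrite mulSGid.
have [/eqP defG minHG] := mingroupP minH; exists H; split=> //.
have nNH := subset_trans sHG nNG.
have nKH : H \subset 'N(N :&: H) by rewrite normsI ?normG.
have nilHK : nilpotent (H / (N :&: H)).
  by rewrite (isog_nil (second_isog nNH)) (nilpotentS (quotientS N sHG)).
have nsP p (P : {group gT}) : p.-Sylow(H) P -> P <| H.
  move=> sylP; have sPH := pHall_sub sylP.
  have nKP := subset_trans sPH nKH.
  have nsPK : (N :&: H) <*> P <| H.
    rewrite norm_joinEr // -quotientK //.
    have nsKH : N :&: H <| H by rewrite /normal subsetIr.
    rewrite -[X in _ <| X](quotientGK nsKH) cosetpre_normal.
    rewrite (nilpotent_Hall_pcore nilHK (quotient_pHall nKP sylP)).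
    exact: pcore_normal.
  have sylPK : p.-Sylow((N :&: H) <*> P) P.
    by apply: pHall_subl (joing_subr _ _) _ sylP; rewrite join_subG subsetIr.
  have defH := Frattini_arg nsPK sylPK.
  suff <- : 'N_H(P) = H by apply: normalSG.
  apply: minHG (subsetIl _ _); apply/eqP.
  apply/eqP; rewrite eqEsubset mul_subG //= ?(subset_trans (subsetIl _ _)) //.
  have sJ : (N :&: H) <*> P \subset N * 'N_H(P).
    rewrite norm_joinEr // mulgSS ?subsetIl // subsetI sPH; exact: normG.
  suff : N * H \subset N * 'N_H(P) by rewrite defG.
  have sHN : H \subset N * 'N_H(P).
    suff: (N :&: H) <*> P * 'N_H(P) \subset N * 'N_H(P) by rewrite defH.
    by have := mulSg 'N_H(P) sJ; rewrite -mulgA mulGid.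
  by have := mulgS N sHN; rewrite mulgA mulGid.
have sHF : #|H| %| #|'F(H)|.
  apply/dvdn_partP => // p _; have [P sylP] := Sylow_exists p H.
  rewrite -(card_Hall sylP) cardSg // Fitting_max ?(nsP p) //.
  exact: pgroup_nil (pHall_pgroup sylP).
suff <- : 'F(H) = H by apply: Fitting_nil.
apply/eqP; rewrite eqEcard Fitting_sub dvdn_leq //.
Qed.

End FittingTools.

(** By coprimality the kernel on [D / 'Phi(D)] comes from ['C_Z(D)], so the coprime nilpotent bound
    applies to that quotient. *)
Lemma coprime_index_Phi (gT : finGroupType) (p : nat) (D Z : {group gT}) :
    p.-group D -> nilpotent Z -> Z \subset 'N(D) -> coprime #|D| #|Z| ->
  #|Z : 'L_3(Z) <*> 'C_Z(D)| <= #|D : 'Phi(D)|.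
Proof.
move=> pD nilZ nDZ coDZ.
have [D1 | ntD] := eqsVneq D 1.
  have -> : 'C_Z(D) = Z by apply/setIidPl; rewrite D1 cents1.
  by rewrite (joing_idPr (lcn_sub _ _)) indexgg indexg_gt0.
have nPZ : Z \subset 'N('Phi(D)) := char_norm_trans (Phi_char D) nDZ.
have nPD : D \subset 'N('Phi(D)) := normal_norm (Phi_normal D).
have tiZP : Z :&: 'Phi(D) = 1.
  by apply/coprime_TIg; rewrite coprime_sym (coprimeSg (Phi_sub D)).
have sC : 'C_(Z / 'Phi(D))(D / 'Phi(D)) \subset 'C_Z(D) / 'Phi(D).
  apply/subsetP=> _ /setIP[/morphimP[x nPx Zx ->] cDx].
  apply: mem_quotient; rewrite inE Zx /= -sub1set -gen_subG -/<[x]>.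
  have sxZ : <[x]> \subset Z by rewrite cycle_subG.
  apply: (coprime_Phi_cent pD); first exact: subset_trans nDZ.
    exact: coprimegS coDZ.
  rewrite -quotient_cents2 ?cycle_subG //.
  by rewrite centsC quotient_cycle // cycle_subG.
have abDP : abelian (D / 'Phi(D)) := abelem_abelian (Phi_quotient_abelem pD).
have ntDP : (D / 'Phi(D))%G :!=: 1.
  rewrite -cardG_gt1 card_quotient // indexg_gt1.
  by have /andP[] := Phi_proper ntD.
have := nilpotent_class2_bound (quotient_nil _ nilZ) (quotient_norms _ nDZ) abDP
  (coprime_morph _ coDZ) ntDP.
rewrite card_quotient // => /ltnW; apply: leq_trans.
have sCZ := subsetIl Z 'C(D); have sLZ := lcn_sub 3 Z.
have <- : #|Z / 'Phi(D) : ('L_3(Z) <*> 'C_Z(D)) / 'Phi(D)| =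
          #|Z : 'L_3(Z) <*> 'C_Z(D)|.
  by rewrite index_quotient_eq ?tiZP ?sub1G // join_subG sLZ.
rewrite dvdn_leq ?indexg_gt0 // indexgS //=.
rewrite quotientY ?(subset_trans _ nPZ) // /quotient morphim_lcn //.
by rewrite genS ?setUS.
Qed.

(* The Sylow [p]-subgroup of [Y] lies in [C_Y(D)], so only ['O_p^'(Y)], which acts
   coprimely, contributes to the index. *)
Lemma nilpotent_index_Phi (gT : finGroupType) (p : nat) (D Y : {group gT}) :
    p.-group D -> nilpotent Y -> Y \subset 'N(D) -> 'O_p(Y) \subset 'C(D) ->
  #|Y : 'L_3(Y) <*> 'C_Y(D)| <= #|D : 'Phi(D)|.
Proof.
move=> pD nilY nDY cDYp; set Z := 'O_p^'(Y)%G.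
have sZY : Z \subset Y := pcore_sub _ _.
have nilZ := nilpotentS sZY nilY; have nDZ := subset_trans sZY nDY.
have coDZ : coprime #|D| #|Z| := pnat_coprime pD (pcore_pgroup _ _).
apply: leq_trans (coprime_index_Phi pD nilZ nDZ coDZ).
have nsLC : 'L_3(Y) <*> 'C_Y(D) <| Y.
  apply: normalY; first exact: lcn_normal.
  by rewrite /normal subsetIl normsI ?normG ?norms_cent.
have defY : ('L_3(Y) <*> 'C_Y(D)) * Z = Y.
  apply/eqP; rewrite eqEsubset mul_subG ?(normal_sub nsLC) //=.
  have [_ defY _ _] := dprodP (nilpotent_pcoreC p nilY).
  suff: 'O_p(Y) * 'O_p^'(Y) \subset ('L_3(Y) <*> 'C_Y(D)) * Z by rewrite defY.
  apply/mulSg/(subset_trans _ (joing_subr _ _)).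
  by rewrite subsetI pcore_sub.
have -> : #|Y : 'L_3(Y) <*> 'C_Y(D)| = #|('L_3(Y) <*> 'C_Y(D)) * Z : 'L_3(Y) <*> 'C_Y(D)|.
  by rewrite defY.
rewrite indexMg dvdn_leq ?indexg_gt0 // indexgS //.
by rewrite genS // setUSS ?lcnS ?setSI.
Qed.

(** * A minimal subgroup on which ['O_p(H)] acts faithfully *)

Section MinimalFaithful.

Variables (gT : finGroupType) (p : nat) (H : {group gT}).
Implicit Types (C D K F : {group gT}) (r : nat).
Hypothesis nilH : nilpotent H.

Let P := 'O_p(H)%G.

(* What remains of the minimality of [C] when only one [O_r(C)] is replaced by a
   smaller subgroup. *)
Definition reduced C := forall r K,
  K \subset 'O_r(C) -> H \subset 'N(K) -> 'C_P(K) \subset 'C('O_r(C)) ->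
  K :=: 'O_r(C).

Lemma reduced_exists F :
    nilpotent F -> H \subset 'N(F) -> 'C_P(F) = 1 ->
  exists C, [/\ C \subset F, H \subset 'N(C), 'C_P(C) = 1 & reduced C].
Proof.
move=> nilF nFH cPF.
pose ok (C : {group gT}) := (H \subset 'N(C)) && ('C_P(C) == 1).
have [|C minC sCF] := @mingroup_exists _ ok F; first by rewrite /ok nFH cPF /=.
have [/andP[nCH /eqP cPC] minCH] := mingroupP minC.
exists C; split=> // r K sKD nKH sCK; have nilC := nilpotentS sCF nilF.
have [_ defC cDE tiDE] := dprodP (nilpotent_pcoreC r nilC).
set D := 'O_r(C)%G in defC cDE tiDE sKD sCK *; set E := 'O_r^'(C)%G in defC cDE tiDE.
have sDC : D \subset C := pcore_sub _ _.
have sEC : E \subset C := pcore_sub _ _.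
have nEH : H \subset 'N(E) := char_norm_trans (pcore_char _ _) nCH.
have defKE : K <*> E = K * E.
  by rewrite cent_joinEr // (subset_trans cDE) ?centS.
have CE : K <*> E = C.
  apply: minCH; last by rewrite join_subG (subset_trans sKD).
  rewrite /ok normsY //=; apply/eqP/trivgP; rewrite -cPC subsetI subsetIl /=.
  suff : 'C_P(K <*> E) \subset 'C(D * E) by rewrite defC.
  rewrite centM subsetI; apply/andP; split.
    by apply: subset_trans sCK; rewrite setIS // centS ?joing_subl.
  by rewrite subIset // centS ?orbT ?joing_subr.
apply/eqP; rewrite eqEsubset sKD /=.
have sKD' := mulSGid sKD.
suff : D :&: (K * E) \subset K by rewrite -defKE CE (setIidPl sDC).
by rewrite setIC -group_modl // setIC tiDE mulg1.
Qed.

Variable C : {group gT}.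
Hypotheses (nilC : nilpotent C) (p'C : p^'.-group C) (nCH : H \subset 'N(C)).
Hypothesis redC : reduced C.

Let sPH : P \subset H := pcore_sub _ _.
Let pP : p.-group P := pcore_pgroup _ _.

Let p'D r : p^'.-group 'O_r(C).
Proof. exact: pgroupS (pcore_sub _ _) p'C. Qed.

Let coDA r (A : {group gT}) : A \subset P -> coprime #|'O_r(C)| #|A|.
Proof.
move=> sAP; rewrite coprime_sym.
by apply: pnat_coprime (p'D r); apply: pgroupS pP.
Qed.

Let nDH r : H \subset 'N('O_r(C)).
Proof. exact: char_norm_trans (pcore_char _ _) nCH. Qed.

(** For [r != p], reducedness applies to ['C_D(R)]: whatever in [P] centralizes it centralizes [D]
    by [coprime_cent_AxB]. *)
Lemma reduced_pcore_cent r : 'O_r(H) \subset 'C('O_r(C)).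
Proof.
have [-> | neq_rp] := eqVneq r p.
  have -> : 'O_p(C) = 1; last exact: cents1.
  apply/eqP; rewrite -(setIid 'O_p(C)) coprime_TIg //.
  exact: pnat_coprime (pcore_pgroup _ _) (p'D _).
have nRH : H \subset 'N('O_r(H)) := gFnorm _ _.
set D := 'O_r(C)%G; set R := 'O_r(H)%G.
have sRH : R \subset H := pcore_sub _ _.
suff defD : 'C_D(R) = D by rewrite centsC -defD subsetIr.
apply: redC; first exact: subsetIl.
  by rewrite normsI ?nDH ?norms_cent.
set A := 'C_P('C_D(R))%G.
have sAP : A \subset P := subsetIl _ _; have sAH := subset_trans sAP sPH.
have rP : r^'.-group P.
  apply: sub_pgroup pP => q; rewrite !inE => /eqP->.
  by rewrite eq_sym.
have coRA : coprime #|R| #|A|.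
  exact: pnat_coprime (pcore_pgroup _ _) (pgroupS sAP rP).
apply: (coprime_cent_AxB (pcore_pgroup r C) (pcore_pgroup r H)).
- exact: pgroupS sAP rP.
- exact: subset_trans sAH (nDH r).
- exact: subset_trans sRH (nDH r).
- exact: sub_nilpotent_cent2 nilH sRH sAH coRA.
by rewrite subsetIr.
Qed.

(** Reducedness gives [D = [~: D, P]], so [P] has no nontrivial fixed point on [D / 'Phi(D)]. *)
Lemma reduced_cent_Phi r : 'C_('O_r(C))(P) \subset 'Phi('O_r(C)).
Proof.
set D := 'O_r(C)%G; have nDP := subset_trans sPH (nDH r).
have solD : solvable D := nilpotent_sol (nilpotentS (pcore_sub _ _) nilC).
have defD : [~: D, P] = D.
  apply: redC; first by rewrite commg_subl.
    by rewrite normsR ?nDH ?gFnorm.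
  have sAP := subsetIl P 'C([~: D, P]).
  apply: coprime_stab; rewrite ?coDA ?(subset_trans sAP) //.
  by rewrite centsC (subset_trans (subsetIr _ _)) // centS // commgS.
have nPhiP : P \subset 'N('Phi(D)) := char_norm_trans (Phi_char D) nDP.
have nPhiD := normal_norm (Phi_normal D).
have abDP : abelian (D / 'Phi(D)).
  exact: abelem_abelian (Phi_quotient_abelem (pcore_pgroup r C)).
rewrite -quotient_sub1; last exact: subset_trans (subsetIl _ _) nPhiD.
apply: subset_trans (quotient_subcent _ _ _) _ => /=.
have := coprime_abel_cent_TI (quotient_norms _ nDP) (coprime_morph _ (coDA r (subxx P))) abDP.
by rewrite -quotientR // defD => ->.
Qed.

(** By reducedness each ['O_r(C)] equals its Thompson critical subgroup, which has class at most
    2. *)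
Lemma reduced_lcn3 : 'L_3(C) = 1.
Proof.
apply/eqP; apply: contraT => ntL.
have r_pr : prime (pdiv #|'L_3(C)|) by rewrite pdiv_prime ?cardG_gt1.
set r := pdiv _ in r_pr; set D := 'O_r(C)%G.
have pD : r.-group D := pcore_pgroup _ _.
have solD := pgroup_sol pD.
have [K [charK _ sRZ cK]] := Thompson_critical pD.
have sKD := char_sub charK.
have nDK : D \subset 'N(K) := normal_norm (char_normal charK).
have defD : K :=: D.
  apply: redC => //; first exact: char_norm_trans charK (nDH r).
  set A := 'C_P(K)%G; have sAP : A \subset P := subsetIl _ _.
  have nDA : A \subset 'N(D) := subset_trans (subset_trans sAP sPH) (nDH r).
  apply: (coprime_stab nDA (coDA r sAP) solD).
  have cAK : K \subset 'C(A) by rewrite centsC subsetIr.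
  apply: (subset_trans _ cAK); apply: (@subset_trans _ _ 'Z(K)); last exact: subsetIl.
  rewrite -cK subsetI commg_subl nDA; apply/commG1P.
  apply: three_subgroup.
    by have /commG1P-> : A \subset 'C(K); rewrite ?comm1G // subsetIr.
  apply/commG1P; rewrite (subset_trans _ cAK) //.
  by rewrite commg_subl.
have L3D : 'L_3(D) = 1.
  apply/commG1P => /=.
  have sD'Z : [~: D, D] \subset 'Z(K) by rewrite -{2}defD.
  apply: subset_trans sD'Z _; rewrite defD; exact: subsetIr.
have r_dv : r %| #|'L_3(C)| := pdiv_dvd _.
have := lcn_dprod 3 (nilpotent_pcoreC r nilC).
rewrite -/(gval D) L3D dprod1g => defL.
have : r^'.-group 'L_3(C) by rewrite -defL (pgroupS (lcn_sub _ _)) ?pcore_pgroup.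
by rewrite /pgroup p'natE // r_dv.
Qed.

End MinimalFaithful.

(** Indices that are not prime contribute 1, and the free bound [m] lets two groups be compared
    factor by factor. *)
Lemma nilpotent_card_pcore_prod (gT : finGroupType) (C : {group gT}) m :
  nilpotent C -> #|C| <= m -> #|C| = (\prod_(r <- iota 0 m.+1) #|'O_r(C)|)%N.
Proof.
move=> nilC leCm; rewrite -{1}(partnT (cardG_gt0 C)) (widen_partn _ leCm).
apply: eq_big_seq => r _.
by rewrite (card_Hall (nilpotent_pcore_Hall r nilC)) p_part.
Qed.

Lemma nilpotent_cent_pcores (gT : finGroupType) (C A : {group gT}) :
  nilpotent C -> (forall r : nat, A \subset 'C('O_r(C))) -> A \subset 'C(C).
Proof.
move=> nilC cA; rewrite centsC; apply/setIidPl/eqP.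
rewrite eqEcard subsetIl dvdn_leq //=.
apply/dvdn_partP => // r _; rewrite -(card_Hall (nilpotent_pcore_Hall r nilC)).
by rewrite cardSg // subsetI pcore_sub centsC cA.
Qed.

Theorem faithful_pmodule_bound (gT : finGroupType) (p : nat) (G V : {group gT}) :
    p.-group V -> abelian V -> V :!=: 1 -> solvable G -> G \subset 'N(V) ->
    'C_G(V) = 1 -> 'O_p(G) = 1 ->
  #|G : 'L_3(G)| < #|V|.
Proof.
move=> pV abV ntV solG nVG cGV Op1.
have nilGL : nilpotent (G / 'L_3(G)).
  apply/lcnP; exists 2.
  have nLG : G \subset 'N('L_3(G)) := normal_norm (lcn_normal _ _).
  by rewrite -[LHS](morphim_lcn _ _ nLG) -/(quotient _ _) trivg_quotient.
have [H [sHG defG nilH]] := nilpotent_supplement (lcn_normal 3 G) nilGL.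
have leGH : #|G : 'L_3(G)| <= #|H : 'L_3(H)|.
  have -> : #|G : 'L_3(G)| = #|'L_3(G) * H : 'L_3(G)| by rewrite defG.
  by rewrite indexMg dvdn_leq ?indexg_gt0 // indexgS // lcnS.
apply: leq_ltn_trans leGH _.
have nilF := Fitting_nil G; set F := 'F(G)%G in nilF.
have p'F : p^'.-group F.
  have := nilpotent_pcoreC p nilF; rewrite p_core_Fitting Op1 dprod1g => <-.
  exact: pcore_pgroup.
have nFG : G \subset 'N(F) := gFnorm _ _.
have cPF : 'C_('O_p(H))(F) = 1.
  apply/trivgP.
  have <- : F :&: 'O_p(H) = 1.
    rewrite setIC; apply: coprime_TIg.
    exact: pnat_coprime (pcore_pgroup p H) p'F.
  rewrite subsetI subsetIl andbT.
  apply: subset_trans (solvable_cent_Fitting solG).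
  by rewrite setSI // (subset_trans (pcore_sub _ _)).
have [C [sCF nCH cPC redC]] := reduced_exists nilF (subset_trans sHG nFG) cPF.
have nilC := nilpotentS sCF nilF; have p'C := pgroupS sCF p'F.
have sCG := subset_trans sCF (Fitting_sub G).
set Q := 'C_H(C)%G.
have sQH : Q \subset H := subsetIl _ _.
have nsQH : Q <| H by rewrite /normal sQH normsI ?normG ?norms_cent.
have cCQ : Q \subset 'C(C) := subsetIr _ _.
have nilQ := nilpotentS sQH nilH.
have p'Q : p^'.-group Q.
  have Q1 : 'O_p(Q) = 1.
    have sOQ : 'O_p(Q) \subset Q := pcore_sub _ _.
    apply/trivgP; rewrite -cPC subsetI (subset_trans sOQ cCQ) andbT.
    rewrite (sub_Hall_pcore (nilpotent_pcore_Hall p nilH)) ?pcore_pgroup //.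
    exact: subset_trans sQH.
  have := nilpotent_pcoreC p nilQ; rewrite Q1 dprod1g => <-; exact: pcore_pgroup.
pose s := [seq 'O_r(C)%G | r : nat <- iota 0 #|C|.+1].
have leHQ : #|H : 'L_3(H) <*> Q| <= \prod_(U <- s) #|U : 'Phi(U)|.
  have sQ : 'C_H(\bigcup_(U <- s) U) \subset Q.
    rewrite subsetI subsetIl /=; apply: nilpotent_cent_pcores => // r.
    have [D1 | ntD] := eqsVneq 'O_r(C) 1; first by rewrite D1 cents1.
    rewrite subIset // centS ?orbT // big_map.
    rewrite (big_rem r) ?subsetUl // mem_iota /= add0n.
    have [_ r_dv _] := pgroup_pdiv (pcore_pgroup r C) ntD.
    by rewrite ltnS dvdn_leq // (dvdn_trans r_dv) ?cardSg ?pcore_sub.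
  have sLC : 'L_3(H) <*> 'C_H(\bigcup_(U <- s) U) \subset 'L_3(H) <*> Q.
    by rewrite genS ?setUS.
  apply: leq_trans (dvdn_leq (indexg_gt0 _ _) (indexgS H sLC)) _.
  apply: (@index_layers gT (fun Y => 'L_3(Y)%G)) => //.
  - by move=> Y Y1; apply: lcnS.
  - by move=> Y; apply: lcn_normal.
  - by move=> _ /mapP[r _ ->]; apply: char_norm_trans (pcore_char _ _) nCH.
  move=> _ Y /mapP[r _ ->] nsYH; have sYH := normal_sub nsYH.
  have nilY := nilpotentS sYH nilH.
  apply: nilpotent_index_Phi (pcore_pgroup r C) nilY _ _.
    exact: subset_trans sYH (char_norm_trans (pcore_char _ _) nCH).
  apply: subset_trans (reduced_pcore_cent nilH p'C nCH redC r).
  rewrite (sub_Hall_pcore (nilpotent_pcore_Hall r nilH)) ?pcore_pgroup //.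
  exact: subset_trans (pcore_sub _ _) sYH.
have leQ : #|H : 'L_3(H)| <= #|H : 'L_3(H) <*> Q| * #|Q : 'L_3(Q)|.
  rewrite -[X in #|Q : X|]joingG1 -[X in #|H : X|]joingG1.
  by apply: index_join_leq; rewrite ?sub1G ?lcn_normal ?lcnS ?lcn_sub ?normal_norm.
(* ['O_r(X)] lies in ['O_r(C)] and is centralized by ['O_p(H)], so it lies in ['Phi('O_r(C))]. *)
set X := (C :&: Q)%G.
have leC : \prod_(U <- s) #|U : 'Phi(U)| * #|X| <= #|C|.
  have sXC : X \subset C := subsetIl _ _.
  have sXH : X \subset H := subset_trans (subsetIr _ _) sQH.
  rewrite (nilpotent_card_pcore_prod (nilpotentS sXC nilC) (subset_leq_card sXC)).
  rewrite [leqRHS](nilpotent_card_pcore_prod nilC (leqnn _)) big_map -big_split /=.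
  apply: leq_prod => r _.
  rewrite mulnC -(Lagrange (Phi_sub 'O_r(C))) leq_mul2r; apply/orP; right.
  apply: subset_leq_card.
  apply: subset_trans (reduced_cent_Phi nilC p'C nCH redC r).
  have sOX : 'O_r(X) \subset X := pcore_sub _ _.
  rewrite subsetI (sub_Hall_pcore (nilpotent_pcore_Hall r nilC)) ?pcore_pgroup //=.
    apply: subset_trans sOX _.
    apply: sub_nilpotent_cent2 nilH (pcore_sub _ _) sXH _.
    exact: pnat_coprime (pcore_pgroup p H) (pgroupS sXC p'C).
  exact: subset_trans sXC.
have cprodCQ : C \* Q = C <*> Q by rewrite cprodEY // centsC.
have defL : 'L_3(C <*> Q) = 'L_3(Q).
  have := lcn_cprod 3 cprodCQ.
  by rewrite (reduced_lcn3 nilC p'C nCH redC) cprod1g.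
have nilCQ : nilpotent (C <*> Q) by rewrite (cprod_nil cprodCQ) nilC.
have p'CQ : p^'.-group (C <*> Q).
  by rewrite cent_joinEr // pgroupM p'C.
have sCQG : C <*> Q \subset G by rewrite join_subG sCG (subset_trans sQH).
have cCQV : 'C_(C <*> Q)(V) = 1.
  by apply/trivgP; rewrite -cGV setSI.
have := nilpotent_class2_bound nilCQ (subset_trans sCQG nVG) abV
  (pnat_coprime pV p'CQ) ntV.
rewrite /= cCQV joingG1 /= defL; apply: leq_ltn_trans.
(* Clearing denominators, the comparison uses [#|C| * #|Q| = #|C <*> Q| * #|X|]. *)
apply: leq_trans leQ _; apply: leq_trans (leq_mul leHQ (leqnn _)) _.
rewrite -(leq_pmul2r (cardG_gt0 'L_3(Q))) -mulnA [(#|Q : _| * _)%N]mulnC.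
rewrite (Lagrange (lcn_sub 3 Q)) [leqRHS]mulnC.
rewrite Lagrange; last by rewrite (subset_trans (lcn_sub 3 Q)) ?joing_subr.
rewrite -(leq_pmul2r (cardG_gt0 X)) mulnAC /= cent_joinEr // -mul_cardG.
by rewrite leq_mul2r leC orbT.
Qed.

(** * Completely reducible modules *)

(** The point is that [Y / D] has trivial [p]-core: its preimage [M] acts on the [p]-group [W] as a
    [p]-group, so it fixes a nontrivial element and, by irreducibility, all of [W]. *)
Lemma irreducible_layer_bound (gT : finGroupType) (G W Y : {group gT}) :
    solvable G -> abelian W -> minnormal W G -> G :&: W = 1 -> Y <| G ->
  #|Y : 'L_3(Y) <*> 'C_Y(W)| < #|W|.
Proof.
move=> solG abW minW tiGW nsYG; have [sYG nYG] := andP nsYG.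
have [nWG ntW abelW] := minnormal_solvable minW (subxx W) (abelian_sol abW).
have [p p_pr /abelem_pgroup pW] := is_abelemP abelW.
have nWY := subset_trans sYG nWG.
have tiYW : Y :&: W = 1 by apply/trivgP; rewrite -tiGW setSI.
set D := 'C_Y(W)%G; have sDY : D \subset Y := subsetIl _ _.
have nDG : G \subset 'N(D) by rewrite normsI ?norms_cent.
have nsDY : D <| Y by rewrite /normal sDY (subset_trans sYG).
have nsDG : D <| G by rewrite /normal (subset_trans sDY).
have Op1 : 'O_p(Y / D) = 1.
  have nsOG : 'O_p(Y / D) <| G / D.
    exact: char_normal_trans (pcore_char _ _) (quotient_normal _ nsYG).
  have [M defM sDM sMY] := inv_quotientS nsDY (pcore_sub p (Y / D)).
  have nsMG : M <| G.
    rewrite -(quotientGK nsDG) -(quotientGK (normalS sDM sMY nsDY)) -defM.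
    by rewrite cosetpre_normal.
  have [sMG nMG] := andP nsMG; have nWM := subset_trans sMG nWG.
  have nDM := subset_trans sMG nDG.
  have [S sylS] := Sylow_exists p M; have sSM := pHall_sub sylS.
  have nWS := subset_trans sSM nWM; have nDS := subset_trans sSM nDM.
  have defMS : D * S = M.
    apply/eqP; rewrite eqEsubset mul_subG //= -quotientSK //.
    have pMD : p.-group (M / D) by rewrite -defM pcore_pgroup.
    have /= -> := nilpotent_Hall_pcore (pgroup_nil pMD) (quotient_pHall nDS sylS).
    by rewrite pcore_pgroup_id.
  have ntCM : 'C_W(M) != 1.
    have nsW : W <| W <*> S by rewrite /normal joing_subl join_subG normG.
    have pWS : p.-group (W <*> S).
      by rewrite norm_joinEr // pgroupM pW (pHall_pgroup sylS).
    apply: contraNneq (meet_center_nil (pgroup_nil pWS) nsW ntW) => CW1.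
    rewrite -subG1 -CW1 subsetI subsetIl /= -defMS centM subsetI.
    rewrite (subset_trans (subsetIl _ _)) /=; last by rewrite centsC subsetIr.
    by rewrite (subset_trans (subsetIr _ _)) // subIset // centS ?orbT ?joing_subr.
  have cMW : 'C_W(M) = W.
    have [_ minWG] := mingroupP minW; apply: minWG (subsetIl _ _).
    by rewrite ntCM normsI ?norms_cent.
  by rewrite defM quotientS1 // subsetI sMY centsC -cMW subsetIr.
have abWD : abelian (W / D) := quotient_abelian _ abW.
have oWD : #|W / D| = #|W| := card_quotient_cent tiYW.
rewrite -(index_quotient_cent nWY) -oWD.
apply: (@faithful_pmodule_bound _ p (Y / D)%G (W / D)%G) => //=.
- exact: quotient_pgroup.
- by rewrite -cardG_gt1 /= oWD cardG_gt1.
- exact: quotient_sol (solvableS sYG solG).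
- exact: norm_quotient_cent.
exact: cent_quotient_cent.
Qed.

Lemma prod_pred_lt (I : eqType) (s : seq I) (f : I -> nat) :
  s != [::] -> (forall i, 0 < f i) -> (\prod_(i <- s) (f i).-1 < \prod_(i <- s) f i)%N.
Proof.
case: s => // i s _ f_gt0; rewrite !big_cons.
apply: (@leq_ltn_trans ((f i).-1 * \prod_(j <- s) f j)%N).
  by rewrite leq_mul2l leq_prod ?orbT // => j _; apply: leq_pred.
by rewrite ltn_pmul2r ?prodn_gt0 // prednK.
Qed.

Lemma bigdprod_faithful_bound (gT : finGroupType) (G V : {group gT}) n
    (W : 'I_n -> {group gT}) :
    solvable G -> abelian V -> V :!=: 1 -> G :&: V = 1 -> 'C_G(V) = 1 ->
    \big[dprod/1]_(i < n) W i = V -> (forall i, minnormal (W i) G) ->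
  #|G : 'L_3(G)| < #|V|.
Proof.
move=> solG abV ntV tiGV cGV defV minW.
have sWV i : W i \subset V by rewrite -(bigdprodWY defV) sub_gen // (bigcup_sup i).
set s := [seq W i | i <- index_enum 'I_n].
have defVs : <<\bigcup_(U <- s) U>> = V by rewrite big_map (bigdprodWY defV).
have oV : #|V| = (\prod_(U <- s) #|U|)%N by rewrite big_map (bigdprod_card defV).
have nts : s != [::].
  by apply: contraNneq ntV => s0; rewrite -defVs s0 big_nil gen0.
have ltP : (\prod_(U <- s) #|U|.-1 < \prod_(U <- s) #|U|)%N.
  by apply: prod_pred_lt => // U; apply: cardG_gt0.
(* Bounding the layers by [#|U|.-1] keeps the final inequality strict. *)
rewrite oV; apply: leq_ltn_trans ltP.
rewrite -[X in #|G : X|]joingG1 -[X in _ <*> X]cGV -[X in 'C_G(X)]defVs cent_gen.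
apply: (@index_layers gT (fun Y => 'L_3(Y)%G)) => //.
- by move=> Y Y1; apply: lcnS.
- by move=> Y; apply: lcn_normal.
- by move=> _ /mapP[i _ ->]; have /andP[] := mingroupp (minW i).
move=> _ Y /mapP[i _ ->] nsYG; rewrite -ltnS prednK //.
apply: irreducible_layer_bound (minW i) _ nsYG => //.
  exact: abelianS (sWV i) abV.
by apply/trivgP; rewrite -tiGV setIS.
Qed.

Section SemidirectModule.

Variables (aT rT : finGroupType) (G : {group aT}) (V : {group rT}).
Variable to : groupAction G V.

Local Notation sd1 := (sdpair1 to).
Local Notation sd2 := (sdpair2 to).

Lemma acts_irreducibly_minnormal (W : {group rT}) :
  W \subset V -> acts_irreducibly G W to -> minnormal (sd1 @* W) (sd2 @* G).
Proof.
move=> sWV /mingroupP[/andP[ntW nWG] minW]; apply/mingroupP; split.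
  rewrite -actsEsd // nWG andbT.
  by rewrite morphim_injm_eq1 ?injm_sdpair1.
move=> U /andP[ntU nUG] sUW; pose X := (sd1 @*^-1 U)%G.
have sX1 : sd1 @* X = U.
  by rewrite morphpreK // (subset_trans sUW) ?morphimS.
have sXV : X \subset V := subsetIl _ _.
rewrite -sX1 (minW X) //.
  rewrite actsEsd //= sX1 nUG andbT.
  by apply: contraNneq ntU => X1; rewrite -sX1 /= X1 morphim1.
by rewrite -(injmSK (injm_sdpair1 to)) // sX1.
Qed.

End SemidirectModule.

Theorem theorem1p1 (gT vT : finGroupType) (G : {group gT}) (V : {group vT})
    (to : groupAction G V)
    (solG : solvable G)
    (abV : abelian V)
    (ntV : V :!=: 1)
    (faithV : [faithful G, on V | to])
    (redV : completely_reducible to) :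
  #|G / [~: G, G, G]| < #|V|.
Proof.
have [n [W [defV irrW]]] := redV.
have sWV i : W i \subset V by rewrite -(bigdprodWY defV) sub_gen // (bigcup_sup i).
have inj1 := injm_sdpair1 to; have inj2 := injm_sdpair2 to.
(* In the semidirect product the action becomes conjugation between subgroups of one group. *)
have := @bigdprod_faithful_bound _ (sdpair2 to @* G)%G (sdpair1 to @* V)%G n
  (fun i => sdpair1 to @* W i)%G.
rewrite /= card_injm //.
have -> : #|sdpair2 to @* G : 'L_3(sdpair2 to @* G)| = #|G / [~: G, G, G]|.
  rewrite -morphim_lcn //.
  rewrite card_quotient ?normal_norm ?(lcn_normal 3) //.
  by rewrite index_injm // lcn_sub.
apply.
- exact: morphim_sol.
- exact: morphim_abelian.
- by rewrite morphim_injm_eq1.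
- by rewrite setIC im_sdpair_TI.
- have := faithV; rewrite /faithful astabEsd // => faith.
  apply/trivgP/subsetP=> _ /setIP[/morphimP[a Ga _ ->] cVa].
  have: a \in G :&: sdpair2 to @*^-1 'C(sdpair1 to @* V).
    by rewrite inE Ga mem_morphpre.
  by move/(subsetP faith)/set1P->; rewrite morph1 inE.
- exact: injm_bigdprod.
by move=> i; apply: acts_irreducibly_minnormal.
Qed.
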